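(* Under the standing assumptions on the random walk in time-inhomogeneous random environment given in the context, the function $U(\xi,y)$, $y\ge 0$, defined in the context, satisfies the following. 1. $U$ is $\sigma(\xi)$-measurable, where $\sigma(\xi)=\sigma(\xi_1,\xi_2,\dots)$, and satisfies the quenched harmonic property $$U(\xi,y)=\mathbb{E}_\xi\left[U(\theta\xi,y+S_1);\tau_y>1\right],\qquad P\text{-a.s.}$$ 2. $U(\xi,y)$ is positive, non-decreasing in $y$, and $$\lim_{y\to\infty}\frac{U(\xi,y)}{y}=1,\qquad P\text{-a.s.}$$
   Context: Model: the environment $\xi=(\xi_n)_{n\ge1}$ is a stationary and ergodic sequence of random variables on a probability space $(\Omega_E,\mathscr{F}_E,P)$ with values in the space of probability laws on $\mathbb{R}$; each realization of $\xi_n$ corresponds to a law $\eta_n$ on $\mathbb{R}$. Given $\xi$, under the quenched probability $\mathbb{P}_\xi$ (expectation $\mathbb{E}_\xi$) the real random variables $X_1,X_2,\dots$ are independent and $X_n$ has law $\eta_n$; $S_0=0$ and $S_n=\sum_{k=1}^n X_k$. The annealed probability $\mathbb{P}$ (expectation $\mathbb{E}$) is given by $\int f\,d\mathbb{P}=\int\left(\int f(\xi,\omega)\,d\mathbb{P}_\xi(\omega)\right)dP$ for nonnegative measurable $f$. Standing assumptions: $\mathbb{E}_\xi(X_1)=0$ $P$-a.s.; $\mathbb{E}(|X_1|^{2+\epsilon})<\infty$ for some $\epsilon>0$; and $\mathbb{P}_\xi(X_1>0)>0$ $P$-a.s. Notation: $\mathbb{E}_\xi(Y;A):=\mathbb{E}_\xi(Y1_A)$.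 For $y\ge0$, $\tau_y:=\inf\{n>0:\ y+S_n\le 0\}$. The shift is $\theta\xi:=(\xi_2,\xi_3,\dots)$; under $\mathbb{P}_{\theta\xi}$ the walk has independent increments with successive laws $\eta_2,\eta_3,\dots$. For $y\ge 0$, $U_n(\xi,y):=\mathbb{E}_\xi(y+S_n;\tau_y>n)$, and $U(\xi,y)$ denotes the limit, which exists for $P$-almost all $\xi$, $U(\xi,y)=\lim_{n\to\infty}U_n(\xi,y)=-\mathbb{E}_\xi(S_{\tau_y})$; $U(\theta\xi,\cdot)$ is the same function evaluated at the environment $\theta\xi$. *)

(* Defs.v *)
From HB Require Import structures.
From mathcomp Require Import all_boot all_order all_algebra.
From mathcomp Require Import all_classical all_reals all_analysis.
From mathcomp Require Import measurable_realfun.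

Set Implicit Arguments.
Unset Strict Implicit.
Unset Printing Implicit Defensive.

Import Order.TTheory GRing.Theory Num.Theory.
Import numFieldNormedType.Exports.

Local Open Scope classical_set_scope.
Local Open Scope ring_scope.

(* Sequences are indexed from 0: [xi 0], [e 0], [X 0] stand for $\xi_1$,
   $\eta_1$, $X_1$, and so on. *)

(* The probability laws on the line, with the sigma-algebra generated by the
   evaluations [mu |-> mu A] on Borel sets [A]. *)
Definition law (R : realType) := pprobability R R.

Definition environment (R : realType) := nat -> law R.

Definition theta (R : realType) (e : environment R) : environment R :=
  fun n => e n.+1.

(* [<<s coordinate_sets f >>] is $\sigma(f_0, f_1, \dots)$. *)
Definition coordinate_sets (T : Type) (d : measure_display)
    (V : measurableType d) (f : nat -> T -> V) : set (set T) :=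
  \bigcup_n preimage_set_system setT (f n) measurable.

Definition cylinder_measurable (R : realType) : set (set (environment R)) :=
  <<s coordinate_sets (fun n (e : environment R) => e n) >>.

Section random_environment.
Context (R : realType) (dE : measure_display) (OmegaE : measurableType dE).
Context (P : probability OmegaE R) (xi : nat -> {mfun OmegaE >-> law R}).

Definition env_at (w : OmegaE) : environment R := fun n => xi n w.

Definition stationary_env : Prop :=
  forall A, cylinder_measurable A ->
    P [set w | A (theta (env_at w))] = P [set w | A (env_at w)].

Definition ergodic_env : Prop :=
  forall A, cylinder_measurable A -> (@theta R) @^-1` A = A ->
    P [set w | A (env_at w)] = 0%E \/ P [set w | A (env_at w)] = 1%E.

(* [OmegaE] equipped with $\sigma(\xi_1, \xi_2, \dots)$. *)
Definition sigma_xi :=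
  g_sigma_algebraType (coordinate_sets (fun n (w : OmegaE) => xi n w)).

End random_environment.

Definition mutually_independent (R : realType) (d : measure_display)
    (Omega : measurableType d) (Q : probability Omega R)
    (X : nat -> {mfun Omega >-> R}) : Prop :=
  forall (J : seq nat) (A : nat -> set R),
    uniq J -> (forall i, measurable (A i)) ->
    Q (\bigcap_(i in [set` J]) (X i @^-1` A i)) =
    (\prod_(i <- J) Q (X i @^-1` A i))%E.

Section quenched_walk.
Context (R : realType) (d : measure_display) (Omega : measurableType d).
(* [Q e] is the quenched probability $\mathbb{P}_e$ in the environment [e]. *)
Context (Q : environment R -> probability Omega R).
Context (X : nat -> {mfun Omega >-> R}).

Definition quenched_increments : Prop :=
  forall e : environment R,
    mutually_independent (Q e) X /\
    (forall n (A : set R), measurable A ->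
       distribution (Q e) (X n) A = (e n : probability R R) A).

Definition walk (n : nat) (x : Omega) : R := \sum_(k < n) X k x.

(* $\inf\emptyset$ is [+oo]. *)
Definition tau (y : R) (x : Omega) : \bar R :=
  ereal_inf [set n%:R%:E | n in [set n | (0 < n)%N /\ y + walk n x <= 0]].

(* $\mathbb{E}_e(Y; A)$ *)
Definition quenched_on (e : environment R) (Y : Omega -> \bar R)
    (A : set Omega) : \bar R := (\int[Q e]_(x in A) Y x)%E.

Definition Un (n : nat) (e : environment R) (y : R) : \bar R :=
  quenched_on e (fun x => (y + walk n x)%:E)
    [set x | (n%:R%:E < tau y x)%E].

(* [limn] is 0 on a sequence that has no limit, so that [0 < U e y] includes
   the existence of the limit. *)
Definition U (e : environment R) (y : R) : \bar R :=
  limn (fun n => Un n e y).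

(* The annealed expectation of a nonnegative [f], where the environment is
   [xi] under [P]. *)
Definition annealed (dE : measure_display) (OmegaE : measurableType dE)
    (P : probability OmegaE R) (xi : nat -> {mfun OmegaE >-> law R})
    (f : OmegaE -> Omega -> \bar R) : \bar R :=
  (\int[P]_w \int[Q (env_at xi w)]_x f w x)%E.

End quenched_walk.

(* Main.v *)
Require Import Defs.
From HB Require Import structures.
From mathcomp Require Import all_boot all_order all_algebra.
From mathcomp Require Import all_classical all_reals all_analysis.
From mathcomp Require Import measurable_realfun.
From mathcomp Require Import ring lra.

(* The walk enters only through E_e[g(y + S_n); tau_y > n], which is an iterate
   of the one-step operators of the laws e_n killed outside (0, +oo).  Write u_n
   for this quantity with g(z) = z, and p_n for P_e(tau_y > n).  For centered
   laws u_n increases with n; this gives existence, positivity, monotonicity in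
   y and (by monotone convergence) harmonicity of the limit.

   Finiteness and U(y)/y -> 1 come from a bound on the growth of u along n = 4^j
   that is uniform in y:
   - an overshoot at a step k is at most L, or is due to a jump larger than L, so
     u_{4n} <= u_n + p_n (L + sum_{k < 4n} E[|X_k|; |X_k| > L]);
   - a Huber-type test function h, with h'' = 1 near 0, h = 0 on the negative
     half-line and h(z) <= sqrt(n) z, gains E[X_k^2; 0 < X_k <= M] / 2 at each
     step from a position below sqrt(n)/2, whence p_n <= c u_n / sqrt(n).
   With L = n^(1/(2 + eps)), n = 4^j, this gives
   u_{4^(j+1)} <= u_{4^j} (1 + B q^j) with q < 1, hence
   U(y) <= (1 + delta) (y + D) for every delta > 0.

   The constants require sum_{k<n} E|X_k|^(2+eps) = O(n) and
   liminf (1/n) sum_{k<n} E[X_k^2; 0 < X_k <= M] > 0 for almost every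
   environment.  Both follow from the maximal ergodic inequality, the second one
   because E[X_1^2; 0 < X_1 <= M] > 0 for large M. *)

Set Implicit Arguments.
Unset Strict Implicit.
Unset Printing Implicit Defensive.

Import Order.TTheory GRing.Theory Num.Theory.
Import numFieldNormedType.Exports.

Local Open Scope classical_set_scope.
Local Open Scope ring_scope.

(** * Killed one-step operators *)

Section environment_space.
Context (R : realType).

Definition env_space :=
  g_sigma_algebraType (coordinate_sets (fun n (e : environment R) => e n)).

Lemma measurable_coordinate n :
  measurable_fun [set: env_space] (fun e : env_space => e n : law R).
Proof.
move=> _ A mA; rewrite setTI; apply: sub_sigma_algebra.
by exists n => //; exists A => //; rewrite setTI.
Qed.

Lemma measurable_to_env d (T : measurableType d) (f : T -> environment R) :
  (forall n, measurable_fun [set: T] (fun t => f t n)) ->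
  measurable_fun [set: T] (f : T -> env_space).
Proof.
move=> mf; apply: (@measurability _ _ T env_space setT f
  (coordinate_sets (fun n (e : environment R) => e n))) => //.
move=> _ [_ [n _ [A mA <-]] <-]; rewrite !setTI.
by have := mf n measurableT A mA; rewrite setTI.
Qed.

Lemma measurable_theta :
  measurable_fun [set: env_space] (@theta R : env_space -> env_space).
Proof. by apply: measurable_to_env => n; exact: measurable_coordinate. Qed.

End environment_space.

Section step.
Context (R : realType).
Implicit Types (mu : probability R R) (g : R -> \bar R) (e : environment R).
Local Open Scope ereal_scope.

(** The inequality is strict because [tau] counts the value 0 as an exit. *)
Definition kill g (z : R) : \bar R := if (0 < z)%R then g z else 0.

Definition step mu g (y : R) : \bar R := \int[mu]_x kill g (y + x)%R.

(* $\mathbb{E}_e(g(y + S_n); \tau_y > n)$ for $y \geq 0$ (lemma [integral_alive]). *)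
Fixpoint killed n e g (y : R) : \bar R :=
  if n is m.+1 then step (e 0%N : probability R R) (killed m (theta e) g) y
  else g y.

Lemma kill_ge0 g : (forall z, 0 <= g z) -> forall z, 0 <= kill g z.
Proof. by move=> g0 z; rewrite /kill; case: ifP. Qed.

Lemma measurable_kill2 d (T : measurableType d) (f : T * R -> \bar R) :
  measurable_fun setT f ->
  measurable_fun [set: T * R] (fun ty => kill (fun z => f (ty.1, z)) ty.2).
Proof.
move=> mf; rewrite /kill; apply: measurable_fun_ifT => //.
- by apply: measurable_fun_ltr => //; exact: measurable_snd.
- by rewrite [X in measurable_fun _ X](_ : _ = f)//; apply/funext => -[].
Qed.

Lemma measurable_kill g : measurable_fun setT g -> measurable_fun setT (kill g).
Proof.
move=> mg; rewrite /kill; apply: measurable_fun_ifT => //.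
exact: measurable_fun_ltr.
Qed.

(** The law is a kernel in the parameter [t], which will carry the environment; joint measurability
    is what the induction in [measurable_killed2] needs. *)
Lemma measurable_step2 d (T : measurableType d) (k : T -> law R)
    (f : T * R -> \bar R) :
  measurable_fun setT k -> (forall z, 0 <= f z) -> measurable_fun setT f ->
  measurable_fun [set: T * R]
    (fun ty => step (k ty.1 : probability R R) (fun z => f (ty.1, z)) ty.2).
Proof.
move=> mk f0 mf.
have mk' : measurable_fun [set: T * R] (fun ty : T * R => k ty.1).
  by apply: (measurableT_comp mk); exact: measurable_fst.
pose F (u : (T * R) * R) := kill (fun z => f (u.1.1, z)) (u.1.2 + u.2)%R.
have F0 u : 0 <= F u by apply: kill_ge0.
have mF : measurable_fun setT F.
  rewrite /F.
  apply: (@measurableT_comp _ _ _ _ _ _ (fun ty : T * R => kill (fun z => f (ty.1, z)) ty.2) _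
    (fun u : (T * R) * R => (u.1.1, (u.1.2 + u.2)%R))).
    exact: measurable_kill2.
  apply: measurable_fun_pair.
    by apply: measurableT_comp => //.
  apply: measurable_funD => //.
  by apply: measurableT_comp => //.
exact: (measurable_fun_integral_finite_kernel F (kprobability mk') F0 mF).
Qed.

Lemma measurable_step mu g : (forall z, 0 <= g z) -> measurable_fun setT g ->
  measurable_fun setT (step mu g).
Proof.
move=> g0 mg.
have := @measurable_step2 _ unit (fun=> mu) (fun z => g z.2)
  (measurable_cst _) (fun z => g0 _) (measurableT_comp mg (@measurable_snd _ _ _ _)).
by move=> m; exact: (measurableT_comp m (pair1_measurable tt)).
Qed.

Lemma step_ge0 mu g : (forall z, 0 <= g z) -> forall y, 0 <= step mu g y.
Proof. by move=> g0 y; apply: integral_ge0 => x _; exact: kill_ge0. Qed.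

Lemma killed_ge0 n e g : (forall z, 0 <= g z) -> forall y, 0 <= killed n e g y.
Proof.
by move=> g0; elim: n e => [|n IH] e y //=; apply: step_ge0 => z; exact: IH.
Qed.

Lemma measurable_killed2 n g : (forall z, 0 <= g z) -> measurable_fun setT g ->
  measurable_fun [set: env_space R * R] (fun ey => killed n ey.1 g ey.2).
Proof.
move=> g0 mg; elim: n => [|n IH] /=.
  by apply: measurableT_comp => //; exact: measurable_snd.
apply: (@measurable_step2 _ (env_space R) (fun e => e 0%N)
  (fun ey => killed n (theta ey.1) g ey.2)).
- exact: measurable_coordinate.
- by move=> z; exact: killed_ge0.
- apply: (measurableT_comp IH (_ : measurable_fun setT
    (fun ey : env_space R * R => (theta ey.1 : env_space R, ey.2)))).
  apply: measurable_fun_pair => //.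
  by apply: measurableT_comp => //; exact: measurable_theta.
Qed.

Lemma measurable_killed n e g : (forall z, 0 <= g z) -> measurable_fun setT g ->
  measurable_fun setT (killed n e g).
Proof.
move=> g0 mg.
by apply: (measurableT_comp (measurable_killed2 n g0 mg) (pair1_measurable (e : env_space R))).
Qed.

(** The definition peels off the first law, this identity the last one, so that a one-step
    inequality at time [n] can be inserted under [killed n]. *)
Lemma killedSr n e g y :
  killed n.+1 e g y = killed n e (step (e n : probability R R) g) y.
Proof.
elim: n e y => [//|n IH] e y.
rewrite -[RHS]/(step (e 0%N) (killed n (theta e) (step (theta e n) g)) y).
rewrite -[LHS]/(step (e 0%N) (killed n.+1 (theta e) g) y).
by congr (step _ _ y); apply/funext => z; exact: IH.
Qed.

End step.

(** * Comparison and linearity of the killed operators *)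

Section killed_algebra.
Context (R : realType).
Implicit Types (mu : probability R R) (g h : R -> \bar R) (e : environment R).
Local Open Scope ereal_scope.

Lemma measurable_kill_shift g y : measurable_fun setT g ->
  measurable_fun setT (fun x : R => kill g (y + x)%R).
Proof.
move=> mg; apply: (measurableT_comp (measurable_kill mg)).
exact: measurable_funD.
Qed.

Lemma le_step mu g h y :
  (forall z, 0 <= g z) -> measurable_fun setT g -> measurable_fun setT h ->
  (forall z, (0 <= z)%R -> g z <= h z) -> step mu g y <= step mu h y.
Proof.
move=> g0 mg mh gh; apply: ge0_le_integral => //.
- by move=> x _; exact: kill_ge0.
- exact: measurable_kill_shift.
- exact: measurable_kill_shift.
- by move=> x _; rewrite /kill; case: ifP => // /ltW; exact: gh.
Qed.

(** Only nonnegative positions matter: the starting point is one, and every later position is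
    filtered by [kill]. *)
Lemma le_killed n e g h y :
  (forall z, 0 <= g z) -> measurable_fun setT g ->
  (forall z, 0 <= h z) -> measurable_fun setT h ->
  (forall z, (0 <= z)%R -> g z <= h z) -> (0 <= y)%R ->
  killed n e g y <= killed n e h y.
Proof.
move=> g0 mg h0 mh gh; elim: n e y => [|n IH] e y y0 /=; first exact: gh.
apply: le_step => [z|||z z0].
- exact: killed_ge0.
- exact: measurable_killed.
- exact: measurable_killed.
- exact: IH.
Qed.

Lemma stepD mu g h y :
  (forall z, 0 <= g z) -> measurable_fun setT g ->
  (forall z, 0 <= h z) -> measurable_fun setT h ->
  step mu (fun z => g z + h z) y = step mu g y + step mu h y.
Proof.
move=> g0 mg h0 mh; rewrite /step -ge0_integralD//.
- by apply: eq_integral => x _; rewrite /kill; case: ifP => //; rewrite adde0.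
- by move=> x _; exact: kill_ge0.
- exact: measurable_kill_shift.
- by move=> x _; exact: kill_ge0.
- exact: measurable_kill_shift.
Qed.

Lemma killedD n e g h y :
  (forall z, 0 <= g z) -> measurable_fun setT g ->
  (forall z, 0 <= h z) -> measurable_fun setT h ->
  killed n e (fun z => g z + h z) y = killed n e g y + killed n e h y.
Proof.
move=> g0 mg h0 mh; elim: n e y => [//|n IH] e y /=.
rewrite -stepD; last 4 first.
- exact: killed_ge0.
- exact: measurable_killed.
- exact: killed_ge0.
- exact: measurable_killed.
by congr (step _ _ y); apply/funext => z; exact: IH.
Qed.

Lemma stepZ mu g c y : (forall z, 0 <= g z) -> measurable_fun setT g ->
  0 <= c -> step mu (fun z => c * g z) y = c * step mu g y.
Proof.
move=> g0 mg c0; rewrite /step -ge0_integralZl//.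
- by apply: eq_integral => x _; rewrite /kill; case: ifP => //; rewrite mule0.
- exact: measurable_kill_shift.
- by move=> x _; exact: kill_ge0.
Qed.

Lemma killedZ n e g c y : (forall z, 0 <= g z) -> measurable_fun setT g ->
  0 <= c -> killed n e (fun z => c * g z) y = c * killed n e g y.
Proof.
move=> g0 mg c0; elim: n e y => [//|n IH] e y /=.
rewrite -stepZ//; last 2 first.
- exact: killed_ge0.
- exact: measurable_killed.
by congr (step _ _ y); apply/funext => z; exact: IH.
Qed.

End killed_algebra.

(** * One step of a centered law *)

Section centered_step.
Context (R : realType).
Implicit Types (mu : probability R R) (g h : R -> \bar R) (e : environment R).
Local Open Scope ereal_scope.

Definition centered mu :=
  mu.-integrable setT (fun x => x%:E) /\ \int[mu]_x x%:E = 0.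

(* The identity on the positions that matter, made nonnegative everywhere so
   that all the integrals are defined in [\bar R] without integrability. *)
Definition ppart (z : R) : \bar R := (Num.max z 0)%:E.

Definition one (z : R) : \bar R := 1.

Lemma ppart_ge0 z : 0 <= ppart z.
Proof. by rewrite lee_fin le_max lexx orbT. Qed.

Lemma measurable_ppart : measurable_fun setT ppart.
Proof. by apply/measurable_EFinP; exact: measurable_funrpos. Qed.

Lemma one_ge0 z : 0 <= one z. Proof. exact: lee01. Qed.

Lemma measurable_one : measurable_fun setT one.
Proof. exact: measurable_cst. Qed.

(** Only the majorant needs a sign: the integral of [f] is at most that of its positive part, which
    [g] dominates. *)
Lemma integral_ge0_le mu (f g : R -> \bar R) :
  measurable_fun setT f -> measurable_fun setT g -> (forall x, 0 <= g x) ->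
  (forall x, f x <= g x) -> \int[mu]_x f x <= \int[mu]_x g x.
Proof.
move=> mf mg g0 fg; rewrite integralE.
apply: (@le_trans _ _ (\int[mu]_x (f^\+ x))).
  by rewrite -[leRHS]sube0 leeB// integral_ge0.
apply: ge0_le_integral => //.
  exact: measurable_funepos.
by move=> x _; rewrite funeposE ge_max fg g0.
Qed.

Lemma integral_affine mu (a b : R) (phi : R -> R) :
  centered mu -> mu.-integrable setT (EFin \o phi) ->
  \int[mu]_x (a + b * x + phi x)%:E = a%:E + \int[mu]_x (phi x)%:E.
Proof.
move=> [imu mu0] iphi.
have ib : mu.-integrable setT (fun x => b%:E * x%:E) by exact: integrableZl.
have ia : mu.-integrable setT (fun=> a%:E).
  exact: finite_measure_integrable_cst.
under eq_integral do rewrite !EFinD EFinM.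
rewrite integralD//; last exact: integrableD.
rewrite integralD// integralZl// mu0 mule0 adde0.
rewrite integral_cst//; congr (_ + _).
transitivity (a%:E * 1); last by rewrite mule1.
by congr (_ * _); exact: probability_setT.
Qed.

(** Killing replaces a value [y + x <= 0] by 0, which can only increase the integrand, and [y + x]
    has mean [y]. *)
Lemma step_ppart_ge mu y : centered mu -> y%:E <= step mu ppart y.
Proof.
move=> cmu.
have := @integral_affine mu y 1 (cst 0%R) cmu (integrable0 _ _).
rewrite integral0 adde0 => <-.
apply: integral_ge0_le => [||x|x].
- apply/measurable_EFinP; apply: measurable_funD => //.
  by apply: measurable_funD => //; apply: measurable_funM.
- exact: measurable_kill_shift measurable_ppart.
- exact: kill_ge0 ppart_ge0 _.
- rewrite mul1r addr0 /kill /ppart; case: ifP => [yx|/negbT]; rewrite lee_fin.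
    by rewrite le_max lexx.
  by rewrite -leNgt.
Qed.

Lemma step_one_le1 mu y : step mu one y <= 1.
Proof.
rewrite (_ : 1 = \int[mu]_x (cst 1%:E x)); last first.
  by rewrite integral_cst// mul1e; apply/esym; exact: probability_setT.
apply: ge0_le_integral => //.
- by move=> x _; exact: kill_ge0 one_ge0 _.
- exact: measurable_kill_shift measurable_one.
- by move=> x _; rewrite /kill /one; case: ifP.
Qed.

Definition big_part (L : R) mu := \int[mu]_x (if L < `|x| then `|x| else 0)%:E.

(** Pointwise comparison with [y + L + x] plus [|x|] on [|x| > L]; centering then removes [x]. At a
    surviving position the left side is [y + x + L]. At a killed one it is 0, and the majorant is
    nonnegative: either [x >= - L], or the extra [|x|] compensates [x]. *)
Lemma step_ppart_one_le mu L y : centered mu -> (0 <= L)%R -> (0 <= y)%R ->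
  step mu ppart y + L%:E * step mu one y <= (y + L)%:E + big_part L mu.
Proof.
move=> cmu L0 y0.
have L1 z : 0 <= L%:E * one z by rewrite mule_ge0// lee_fin.
have mL1 : measurable_fun setT (fun z : R => L%:E * one z) by exact: measurable_cst.
rewrite -(stepZ mu y one_ge0 measurable_one) ?lee_fin//.
rewrite -(stepD mu y ppart_ge0 measurable_ppart L1 mL1).
have iabs : mu.-integrable setT (EFin \o (fun x : R => `|x|%R)).
  by have := integrable_abse cmu.1.
have mphi : measurable_fun setT (fun x : R => if (L < `|x|)%R then `|x|%R else 0%R).
  apply: measurable_fun_ifT => //.
  by apply: measurable_fun_ltr => //; exact: measurableT_comp.
have iphi : mu.-integrable setT
    (EFin \o (fun x : R => if (L < `|x|)%R then `|x|%R else 0%R)).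
  apply: le_integrable iabs => //; first exact/measurable_EFinP.
  by move=> x _; rewrite lee_fin; case: ifP => // _; rewrite normr0.
rewrite -(@integral_affine mu (y + L) 1 _ cmu iphi).
apply: ge0_le_integral => //.
- move=> x _; apply: kill_ge0 => z.
  by rewrite adde_ge0 ?ppart_ge0// mule_ge0// lee_fin.
- apply: measurable_kill_shift; apply: emeasurable_funD => //.
  exact: measurable_ppart.
- apply/measurable_EFinP; apply: measurable_funD => //.
  by apply: measurable_funD => //; apply: measurable_funM.
- move=> x _; rewrite mul1r /kill /ppart /one mule1 -EFinD; case: ifP => [yx|/negbT]; rewrite lee_fin.
    rewrite max_l ?(ltW yx)//.
    by case: ifP => _; have := normr_ge0 x; lra.
  rewrite -leNgt => yx; case: ifPn => [Lx|].
    by have := ler_norm (- x); rewrite normrN; lra.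
  by rewrite -leNgt => Lx; have := ler_norm (- x); rewrite normrN; lra.
Qed.

End centered_step.

(** * The Huber-type test function *)

Section huber.
Context (R : realType).
Implicit Types (mu : probability R R) (e : environment R).

(** Equal to [z ^+ 2 / 2] on [[0, K]], continued by its tangent of slope [K] beyond [K] and by 0
    below 0. *)
Definition huber (K z : R) : R :=
  (Num.max z 0 ^+ 2 - Num.max (z - K) 0 ^+ 2) / 2.

Lemma huber_le0 K z : 0 <= K -> z <= 0 -> huber K z = 0.
Proof.
move=> K0 z0; rewrite /huber !max_r//; last by lra.
by rewrite subrr mul0r.
Qed.

Lemma huber_ge0 K z : 0 <= K -> 0 <= huber K z.
Proof.
by move=> K0; rewrite /huber; case: (leP z 0) => ?; case: (leP (z - K) 0) => ?; nra.
Qed.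

Lemma huber_le K z : 0 <= K -> huber K z <= K * Num.max z 0.
Proof.
by move=> K0; rewrite /huber; case: (leP z 0) => ?; case: (leP (z - K) 0) => ?; nra.
Qed.

(** Convexity: [Num.min z K] is the derivative at [z]. *)
Lemma huber_tangent K z x : 0 <= K -> 0 <= z ->
  huber K z + Num.min z K * x <= huber K (z + x).
Proof.
move=> K0 z0; rewrite /huber.
case: (leP z 0) => ?; case: (leP (z - K) 0) => ?;
  case: (leP (z + x) 0) => ?; case: (leP (z + x - K) 0) => ?; case: (leP z K) => ?; nra.
Qed.

(** The bounds by [K / 2] keep [z + x] at most [K], where the function is exactly quadratic. *)
Lemma huber_quadratic K z x : z <= K / 2 -> x <= K / 2 -> 0 <= z -> 0 <= x ->
  huber K z + z * x + x ^+ 2 / 2 <= huber K (z + x).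
Proof.
move=> zK xK z0 x0; rewrite /huber.
case: (leP z 0) => ?; case: (leP (z - K) 0) => ?;
  case: (leP (z + x) 0) => ?; case: (leP (z + x - K) 0) => ?; nra.
Qed.

Lemma measurable_huber K : measurable_fun setT (huber K).
Proof.
apply: measurable_funM => //; apply: measurable_funB; apply: measurable_funX.
  exact: measurable_funrpos.
apply: measurable_maxr => //.
exact: measurable_funB.
Qed.

Local Open Scope ereal_scope.

Definition small_part (M : R) mu :=
  \int[mu]_x (if (0 < x)%R && (x <= M)%R then x ^+ 2 else 0%R)%:E.

Lemma measurable_small_fun (M : R) : measurable_fun setT
  (fun x : R => if (0 < x)%R && (x <= M)%R then (x ^+ 2)%R else 0%R).
Proof.
apply: measurable_fun_ifT => //.
apply: measurable_and.
- exact: measurable_fun_ltr.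
- exact: measurable_fun_ler.
Qed.

Lemma small_part_ge0 M mu : 0 <= small_part M mu.
Proof.
by apply: integral_ge0 => x _; rewrite lee_fin; case: ifP => // _; exact: sqr_ge0.
Qed.

Lemma integrable_small_fun (M : R) mu : mu.-integrable setT
  (EFin \o fun x : R => if (0 < x)%R && (x <= M)%R then (x ^+ 2)%R else 0%R).
Proof.
apply: (@le_integrable _ _ _ mu setT measurableT _ (fun=> (M ^+ 2)%:E)) => //.
- by apply/measurable_EFinP; exact: measurable_small_fun.
- move=> x _ /=; rewrite lee_fin; case: ifP => [/andP[x0 xM]|_].
    by rewrite !normrX lerXn2r ?nnegrE// !ger0_norm ?(ltW x0)// (le_trans (ltW x0)).
  by rewrite normr0.
- exact: finite_measure_integrable_cst.
Qed.

Lemma small_part_fin_num M mu : small_part M mu \is a fin_num.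
Proof. exact: integrable_fin_num (integrable_small_fun M mu). Qed.

Definition ehuber K z : \bar R := (huber K z)%:E.

Lemma ehuber_ge0 K z : (0 <= K)%R -> 0 <= ehuber K z.
Proof. by move=> K0; rewrite lee_fin huber_ge0. Qed.

Lemma measurable_ehuber K : measurable_fun setT (ehuber K).
Proof. by apply/measurable_EFinP; exact: measurable_huber. Qed.

Lemma kill_ehuber K z : (0 <= K)%R -> kill (ehuber K) z = ehuber K z.
Proof.
by move=> K0; rewrite /kill; case: ltP => // z0; rewrite /ehuber huber_le0.
Qed.

(* From [z <= K / 2] the curvature gains half of [small_part M mu]; beyond,
   convexity suffices since then [1 / 2 <= z / K]. *)
Lemma step_huber_ge (K M : R) mu (z : R) : (0 < M)%R -> (2 * M <= K)%R -> (0 <= z)%R ->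
  centered mu ->
  ehuber K z + small_part M mu * (1 / 2)%:E
    <= step mu (ehuber K) z + small_part M mu * (z / K)%:E.
Proof.
move=> M0 MK z0 cmu; have K0 : (0 <= K)%R by lra.
have mk : measurable_fun setT (fun x => kill (ehuber K) (z + x)%R).
  exact: measurable_kill_shift (measurable_ehuber _).
have k0 x : 0 <= kill (ehuber K) x by apply: kill_ge0 => ?; exact: ehuber_ge0.
have v0 := small_part_ge0 M mu.
have [zK|Kz] := leP z (K / 2)%R.
  apply: (@le_trans _ _ (step mu (ehuber K) z)); last first.
    by rewrite -[leLHS]adde0 leeD2l// mule_ge0// lee_fin divr_ge0.
  have mh : measurable_fun setT (fun x : R => (huber K z + z * x +
      (if (0 < x)%R && (x <= M)%R then x ^+ 2 else 0) * (1 / 2))%R%:E).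
    apply/measurable_EFinP; apply: measurable_funD.
      by apply: measurable_funD => //; exact: measurable_funM.
    by apply: measurable_funM => //; exact: measurable_small_fun.
  have ih := integrableZr measurableT (1 / 2)%R (integrable_small_fun M mu).
  have -> : ehuber K z + small_part M mu * (1 / 2)%:E =
      \int[mu]_x (huber K z + z * x +
      (if (0 < x)%R && (x <= M)%R then x ^+ 2 else 0) * (1 / 2))%R%:E.
    rewrite (integral_affine _ _ cmu ih); congr (_ + _).
    under eq_integral do rewrite EFinM.
    by rewrite integralZr//; exact: integrable_small_fun.
  apply: integral_ge0_le => // x.
  rewrite kill_ehuber// lee_fin; case: ifP => [/andP[x0 xM]|_].
    by have := @huber_quadratic K z x; lra.
  have := huber_tangent x K0 z0; rewrite min_l; lra.
apply: (@le_trans _ _ (ehuber K z + small_part M mu * (z / K)%:E)).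
  apply: leeD2l; apply: lee_wpmul2l => //; rewrite lee_fin.
  by rewrite ler_pdivlMr; lra.
apply: leeD2r.
have -> : ehuber K z = \int[mu]_x (huber K z + Num.min z K * x + cst 0 x)%R%:E.
  by rewrite (integral_affine _ _ cmu (integrable0 _ _)) integral0 adde0.
apply: integral_ge0_le => //.
  apply/measurable_EFinP; apply: measurable_funD => //.
  by apply: measurable_funD => //; exact: measurable_funM.
by move=> x; rewrite kill_ehuber// lee_fin addr0; exact: huber_tangent.
Qed.

End huber.

(** * Growth of the killed mean *)

Section iteration.
Context (R : realType) (e : environment R).
Hypothesis ce : forall k, centered (e k : probability R R).
Local Open Scope ereal_scope.

Local Notation mean n y := (killed n e (@ppart R) y).
Local Notation survival n y := (killed n e (@one R) y).

Lemma ppartE (z : R) : (0 <= z)%R -> ppart z = z%:E.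
Proof. by move=> z0; rewrite /ppart max_l. Qed.

Lemma mean_ge0 n y : 0 <= mean n y.
Proof. by apply: killed_ge0 => z; exact: ppart_ge0. Qed.

Lemma survival_ge0 n y : 0 <= survival n y.
Proof. by apply: killed_ge0 => z; exact: one_ge0. Qed.

Lemma mean_le_succ n y : (0 <= y)%R -> mean n y <= mean n.+1 y.
Proof.
move=> y0; rewrite killedSr; apply: le_killed => //.
- exact: ppart_ge0.
- exact: measurable_ppart.
- by apply: step_ge0 => z; exact: ppart_ge0.
- by apply: measurable_step; [exact: ppart_ge0|exact: measurable_ppart].
- by move=> z z0; rewrite ppartE//; exact: step_ppart_ge.
Qed.

Lemma mean_nondecreasing y : (0 <= y)%R ->
  {homo (fun n => mean n y) : m n / (m <= n)%N >-> m <= n}.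
Proof. by move=> y0; apply/nondecreasing_seqP => n; exact: mean_le_succ. Qed.

Lemma survival_ge_succ n y : (0 <= y)%R -> survival n.+1 y <= survival n y.
Proof.
have q0 := @one_ge0 R; have mq := @measurable_one R.
move=> y0; rewrite killedSr; apply: le_killed => //.
- exact: step_ge0.
- exact: measurable_step.
- by move=> z z0; exact: step_one_le1.
Qed.

Lemma survival_le1 n y : (0 <= y)%R -> survival n y <= 1.
Proof. by move=> y0; elim: n => [//|n]; apply: le_trans; exact: survival_ge_succ. Qed.

Lemma big_part_ge0 (L : R) (mu : probability R R) : 0 <= big_part L mu.
Proof. by apply: integral_ge0 => x _; rewrite lee_fin; case: ifP. Qed.

(** Taken together, the two terms in [L] charge [L] only to the mass killed at this step; jumps
    beyond [L] are charged to all the mass alive at time [n]. *)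
Lemma overshoot1 n L y : (0 <= L)%R -> (0 <= y)%R ->
  mean n.+1 y + L%:E * survival n.+1 y
    <= mean n y + (L%:E + big_part L (e n : probability R R)) * survival n y.
Proof.
move=> L0 y0; set b := big_part _ _.
have b0 : 0 <= L%:E + b by rewrite adde_ge0// ?lee_fin// big_part_ge0.
rewrite -(killedZ _ _ _ (@one_ge0 R) (@measurable_one R) b0).
have L0' : 0 <= L%:E by [].
rewrite -(killedZ _ _ _ (@one_ge0 R) (@measurable_one R) L0').
have m0 c : 0 <= c -> forall z : R, 0 <= c * one z.
  by move=> c0 z; rewrite mule_ge0.
have mm (c : \bar R) : measurable_fun setT (fun z : R => c * one z).
  by apply: emeasurable_funM => //; exact: measurable_one.
have p0 := @ppart_ge0 R; have mp := @measurable_ppart R.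
have q0 := @one_ge0 R; have mq := @measurable_one R.
rewrite -!killedD//; [|exact: m0..].
have s0 c : 0 <= c -> forall z, 0 <= ppart z + c * @one R z.
  by move=> c0 z; rewrite adde_ge0 ?p0// m0.
have ms c : measurable_fun setT (fun z => ppart z + c * @one R z).
  exact: emeasurable_funD.
rewrite killedSr; apply: le_killed => //.
- by apply: step_ge0; exact: s0.
- by apply: measurable_step => //; exact: s0.
- exact: s0.
- move=> z z0; rewrite stepD//; last exact: m0.
  rewrite stepZ// ppartE// mule1 addeA -EFinD.
  exact: step_ppart_one_le.
Qed.

(** The charges [L] telescope, so that [L] appears once however long the interval is. Each
    [big_part] carries the survival at its own time [k >= n], which is at most [survival n y]. *)
Lemma overshoot n m L y : (n <= m)%N -> (0 <= L)%R -> (0 <= y)%R ->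
  mean m y + L%:E * survival m y <= mean n y +
   (L%:E + \sum_(n <= k < m) big_part L (e k : probability R R)) * survival n y.
Proof.
move=> + L0 y0; elim: m => [|m IH].
  by rewrite leqn0 => /eqP ->; rewrite big_geq// adde0.
have L0' : 0 <= L%:E by [].
rewrite leq_eqVlt => /predU1P[<-|]; first by rewrite big_geq// adde0.
rewrite ltnS => nm; apply: (le_trans (overshoot1 m L0 y0)).
have b0 := big_part_ge0 L (e m).
rewrite big_nat_recr//=; set B := \sum_(n <= k < m) _ in IH *.
have B0 : 0 <= B by apply: sume_ge0 => i _; exact: big_part_ge0.
have LB0 : 0 <= L%:E + B by apply: adde_ge0.
rewrite (ge0_muleDl _ L0' b0) [L%:E + (B + _)]addeA (ge0_muleDl _ LB0 b0).
rewrite !addeA; apply: leeD; first exact: IH.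
apply: lee_wpmul2l => //.
have : {homo (fun n => survival n y) : m n / (m <= n)%N >-> n <= m}.
  by apply/nonincreasing_seqP => k; exact: survival_ge_succ.
by apply.
Qed.

(** The case [L = 0] from time 0: not uniform in [n], but of slope 1 in [y]. *)
Lemma mean_le n y : (0 <= y)%R ->
  mean n y <= y%:E + \sum_(0 <= k < n) big_part 0 (e k : probability R R).
Proof.
move=> y0; have := overshoot (leq0n n) (lexx 0%R) y0.
by rewrite mul0e adde0 add0e /= [one y]/= mule1 ppartE.
Qed.

(** Sum of the inequalities [step_huber_ge] along the killed walk. Survival decreases and the mean
    increases in time, so both may be evaluated at the final time. *)
Lemma mean_huber (K M : R) n y : (0 < M)%R -> (2 * M <= K)%R -> (0 <= y)%R ->
  (\sum_(0 <= k < n) small_part M (e k : probability R R)) * (1 / 2)%:E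
      * survival n y
  <= killed n e (ehuber K) y +
    (\sum_(0 <= k < n) small_part M (e k : probability R R)) * (1 / K)%:E
      * mean n y.
Proof.
move=> M0 MK y0; have K0 : (0 <= K)%R by lra.
have h0 : forall z, 0 <= ehuber K z by move=> z; exact: ehuber_ge0.
have mh := measurable_ehuber K.
have p0 := @ppart_ge0 R; have mp := @measurable_ppart R.
have q0 := @one_ge0 R; have mq := @measurable_one R.
have V0 m : 0 <= \sum_(0 <= k < m) small_part M (e k : probability R R).
  by apply: sume_ge0 => i _; exact: small_part_ge0.
elim: n => [|n IH].
  by rewrite big_geq// !mul0e adde0; apply: ehuber_ge0.
rewrite !big_nat_recr//=.
rewrite -/(killed n.+1 e (@one R) y) -/(killed n.+1 e (ehuber K) y) -/(killed n.+1 e (@ppart R) y).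
have v0 := small_part_ge0 M (e n : probability R R).
have K1 : (0 <= 1 / K)%R by rewrite divr_ge0.
(* [step_huber_ge] for the law [e n], integrated over the position at time [n]. *)
have S : killed n e (ehuber K) y + small_part M (e n : probability R R) * (1 / 2)%:E * survival n y <=
   killed n.+1 e (ehuber K) y + small_part M (e n : probability R R) * (1 / K)%:E * mean n y.
  have c0 : 0 <= small_part M (e n : probability R R) * (1 / 2)%:E by rewrite mule_ge0.
  have d0 : 0 <= small_part M (e n : probability R R) * (1 / K)%:E by rewrite mule_ge0.
  have cq0 z : 0 <= small_part M (e n : probability R R) * (1 / 2)%:E * @one R z.
    exact: mule_ge0.
  have dp0 z : 0 <= small_part M (e n : probability R R) * (1 / K)%:E * @ppart R z.
    by apply: mule_ge0 => //; exact: p0.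
  have mcq := emeasurable_funM
    (measurable_cst (small_part M (e n : probability R R) * (1 / 2)%:E)) mq.
  have mdp := emeasurable_funM
    (measurable_cst (small_part M (e n : probability R R) * (1 / K)%:E)) mp.
  have sh0 := step_ge0 (e n : probability R R) h0.
  have msh := measurable_step (e n : probability R R) h0 mh.
  rewrite -(killedZ _ _ _ q0 mq c0) -(killedZ _ _ _ p0 mp d0) killedSr.
  rewrite -(killedD _ _ _ h0 mh cq0 mcq) -(killedD _ _ _ sh0 msh dp0 mdp).
  apply: le_killed => //.
  - by move=> z; exact: adde_ge0.
  - exact: emeasurable_funD.
  - by move=> z; exact: adde_ge0.
  - exact: emeasurable_funD.
  move=> z z0; rewrite mule1 ppartE// -muleA -EFinM.
  rewrite (_ : (1 / K * z = z / K)%R); last by rewrite mul1r mulrC.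
  exact: step_huber_ge.
move: (small_part M _) v0 S => v v0 S.
move: (\sum_(0 <= k < n) _) (V0 n) IH => V {}V0 IH.
rewrite !(ge0_muleDl _ V0 v0) !ge0_muleDl ?mule_ge0//.
apply: (@le_trans _ _ (V * (1 / 2)%:E * survival n y + v * (1 / 2)%:E * survival n y)).
  by apply: leeD; apply: lee_wpmul2l; rewrite ?mule_ge0//; exact: survival_ge_succ.
apply: (@le_trans _ _ (killed n e (ehuber K) y + V * (1 / K)%:E * mean n y +
    v * (1 / 2)%:E * survival n y)); first exact: leeD2r.
rewrite addeAC; apply: (@le_trans _ _ (killed n.+1 e (ehuber K) y +
   v * (1 / K)%:E * mean n y + V * (1 / K)%:E * mean n y)); first exact: leeD2r.
rewrite addeAC -addeA; apply: leeD2l; apply: leeD;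
  by apply: lee_wpmul2l; rewrite ?mule_ge0//; exact: mean_le_succ.
Qed.

Lemma killed_huber_le (K : R) n y : (0 <= K)%R -> (0 <= y)%R ->
  killed n e (ehuber K) y <= K%:E * mean n y.
Proof.
move=> K0 y0; have p0 := @ppart_ge0 R; have mp := @measurable_ppart R.
rewrite -killedZ//; apply: le_killed => //.
- by move=> z; exact: ehuber_ge0.
- exact: measurable_ehuber.
- by move=> z; rewrite mule_ge0// p0.
- exact: emeasurable_funM.
- by move=> z z0; rewrite -EFinM lee_fin; exact: huber_le.
Qed.

Lemma big_part_fin_num (L : R) k : big_part L (e k : probability R R) \is a fin_num.
Proof.
apply: integrable_fin_num => //.
apply: le_integrable (integrable_abse (ce k).1) => //.
- apply/measurable_EFinP; apply: measurable_fun_ifT => //.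
  by apply: measurable_fun_ltr => //; exact: measurableT_comp.
- by move=> x _ /=; rewrite lee_fin; case: ifP => // _; rewrite normr0.
Qed.

Lemma mean_fin_num n y : (0 <= y)%R -> mean n y \is a fin_num.
Proof.
move=> y0; rewrite ge0_fin_numE ?mean_ge0//.
apply: (le_lt_trans (mean_le n y0)).
rewrite lte_add_pinfty ?ltry// lte_sum_pinfty// => i _.
by rewrite ltey_eq big_part_fin_num.
Qed.

Lemma survival_fin_num n y : (0 <= y)%R -> survival n y \is a fin_num.
Proof.
move=> y0; rewrite ge0_fin_numE ?survival_ge0//.
by apply: (le_lt_trans (survival_le1 n y0)); exact: ltry.
Qed.

End iteration.

(** * Growth along powers of 4 and the uniform bound on the mean *)

Section growth.
Context (R : realType) (e : environment R) (eps C c M : R).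
Local Notation law_at k := (e k : probability R R).

Definition moment (mu : probability R R) : \bar R :=
  (\int[mu]_x (`|x| `^ (2 + eps))%:E)%E.

Hypothesis eps0 : 0 < eps.

Lemma measurable_moment_fun :
  measurable_fun setT (fun x : R => `|x| `^ (2 + eps)).
Proof.
by apply: (measurableT_comp (measurable_powR _)).
Qed.

(** If [|x| > L], then [|x|] is at most [L] times the power [2 + eps] of [|x| / L]. *)
Lemma big_part_le_moment (mu : probability R R) (L : R) : 0 < L ->
  (big_part L mu <= (L / L `^ (2 + eps))%:E * moment mu)%E.
Proof.
move=> L0; have q0 : 0 <= L / L `^ (2 + eps) by rewrite divr_ge0 ?powR_ge0// ltW.
have mf : measurable_fun setT (fun x : R => (`|x| `^ (2 + eps))%:E).
  by apply/measurable_EFinP; exact: measurable_moment_fun.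
have f0 (x : R) : setT x -> (0 <= (`|x| `^ (2 + eps))%:E)%E by rewrite lee_fin powR_ge0.
rewrite /moment -(ge0_integralZl mu measurableT mf f0)//.
apply: ge0_le_integral => //.
- by move=> x _; rewrite lee_fin; case: ifP.
- apply/measurable_EFinP; apply: measurable_fun_ifT => //.
  by apply: measurable_fun_ltr => //; exact: measurableT_comp.
- apply/measurable_EFinP; apply: measurable_funM => //.
  exact: measurable_moment_fun.
- move=> x _; rewrite -EFinM lee_fin; case: ifPn => [Lx|_]; last first.
    by rewrite mulr_ge0// powR_ge0.
  have x0 : 0 < `|x| by exact: lt_trans Lx.
  have E (t : R) : 0 < t -> t `^ (2 + eps) = t * t `^ (1 + eps).
    move=> t0; rewrite -[t in t * _]powRr1 ?ltW// -powRD; last first.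
      by apply/implyP => _; rewrite gt_eqF.
    by congr (_ `^ _); ring.
  have PQ : L `^ (1 + eps) <= `|x| `^ (1 + eps).
    by rewrite ge0_ler_powR ?nnegrE ?ltW// addr_gt0.
  have P0 : 0 < L `^ (1 + eps) by rewrite powR_gt0.
  rewrite !E//; move: (L `^ _) (`|x| `^ _) P0 PQ => p q P0 PQ.
  rewrite (_ : L / (L * p) * (`|x| * q) = `|x| * (q / p)).
    by rewrite ler_peMr// ler_pdivlMr// mul1r.
  by field; rewrite !gt_eqF.
Qed.

Hypothesis ce : forall k, centered (law_at k).
Hypothesis C0 : 0 <= C.
Hypothesis c0 : 0 < c.
Hypothesis M0 : 0 < M.
Hypothesis moments : forall n,
  (\sum_(0 <= k < n) moment (law_at k) <= (C * n%:R)%:E)%E.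
Hypothesis smalls : forall n,
  ((c * n%:R)%:E <= \sum_(0 <= k < n) small_part M (law_at k))%E.

Local Notation mean n y := (killed n e (@ppart R) y).
Local Notation survival n y := (killed n e (@one R) y).

(** The time is a power of 4 so that its square root [K = 2 ^+ j] is exact. The Huber function is at
    most [K * z] on [z >= 0] and the accumulated curvature [V] is at least [c * K ^+ 2]; solving
    [V * p / 2 <= K * u + V * u / K] for [p] gives the constant. *)
Lemma survival_le_mean j y : 2 * M <= 2 ^+ j -> 0 <= y ->
  (survival (4 ^ j)%N y <= (2 * (c^-1 + 1) / 2 ^+ j)%:E * mean (4 ^ j)%N y)%E.
Proof.
move=> Mj y0; set n := (4 ^ j)%N; set K : R := 2 ^+ j in Mj *.
have K0 : 0 < K by rewrite exprn_gt0.
have nK : n%:R = K ^+ 2 :> R.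
  by rewrite /n /K natrX -exprM mulnC exprM; congr (_ ^+ _); ring.
have := smalls n; have := mean_huber ce n M0 Mj y0.
have := killed_huber_le e n (ltW K0) y0; have := mean_ge0 e n y.
have /fineK <- := survival_fin_num e n y0.
have /fineK <- := mean_fin_num ce n y0.
have -> : (\sum_(0 <= k < n) small_part M (law_at k) =
    (\sum_(0 <= k < n) fine (small_part M (law_at k)))%:E)%E.
  by rewrite -sumEFin; apply: eq_bigr => k _; rewrite fineK// small_part_fin_num.
move: (fine (survival n y)) (fine (mean n y)) (\sum_(0 <= k < n) _)
  (killed n e (ehuber K) y) => p u V h.
rewrite -!EFinM. move=> u0 hu h2 V1. rewrite lee_fin in V1; rewrite nK in V1. rewrite lee_fin in u0. rewrite lee_fin.
have : (V * (1 / 2) * p <= K * u + V * (1 / K) * u)%R.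
  by rewrite -lee_fin (le_trans h2)// EFinD leeD2r.
move=> H; have V0 : 0 < V.
  by apply: lt_le_trans V1; rewrite mulr_gt0// exprn_gt0.
(* [V] is only bounded below, so it can be traded for [c * K ^+ 2] only when its factor
   [p * K - 2 * u] is positive; otherwise the claim is immediate. *)
have [pu|pu] := leP (p * K) (2 * u).
  rewrite -(ler_pM2r K0) mulrAC divfK ?gt_eqF//.
  apply: (le_trans pu); rewrite ler_wpM2r// ler_peMr//.
  by rewrite lerDr invr_ge0 ltW.
have H2 : V * (p * K - 2 * u) <= 2 * K ^+ 2 * u.
  have : V * (1 / 2) * p * (2 * K) <= (K * u + V * (1 / K) * u) * (2 * K).
    by rewrite ler_wpM2r// mulr_ge0// ltW.
  have E : V * (1 / K) * u * (2 * K) = 2 * V * u by field; rewrite gt_eqF.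
  lra.
have : c * K ^+ 2 * (p * K - 2 * u) <= 2 * K ^+ 2 * u.
  by apply: le_trans H2; rewrite ler_wpM2r// subr_ge0 ltW.
rewrite -mulrA [K ^+ 2 * _]mulrC mulrA -[2 * K ^+ 2 * u]mulrAC.
rewrite ler_pM2r ?exprn_gt0// => H3.
rewrite mulrAC ler_pdivlMr// -(ler_pM2l c0).
rewrite (_ : c * (2 * (c^-1 + 1) * u) = 2 * u + 2 * c * u); last first.
  by field; rewrite gt_eqF.
nra.
Qed.

(** By [1 + t <= expR t]. The exponent is the geometric sum of [B * q ^+ k] over [j <= k < i], hence
    small for large [j], uniformly in [i]. *)
Lemma gronwall (a : nat -> R) (B q : R) j0 : 0 <= B -> 0 < q -> q < 1 ->
  (forall j, 0 <= a j) ->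
  (forall j, (j0 <= j)%N -> a j.+1 <= a j * (1 + B * q ^+ j)) ->
  forall j i, (j0 <= j)%N -> (j <= i)%N ->
  a i <= a j * expR (B * (q ^+ j - q ^+ i) / (1 - q)).
Proof.
move=> B0 q0 q1 a0 H j i jj; elim: i => [|i IH].
  by rewrite leqn0 => /eqP ->; rewrite subrr mulr0 mul0r expR0 mulr1.
rewrite leq_eqVlt => /predU1P[->|]; first by rewrite subrr mulr0 mul0r expR0 mulr1.
rewrite ltnS => ji; apply: (le_trans (H i (leq_trans jj ji))).
have Bi : 0 <= B * q ^+ i by rewrite mulr_ge0// exprn_ge0// ltW.
apply: (@le_trans _ _ (a j * expR (B * (q ^+ j - q ^+ i) / (1 - q)) * (1 + B * q ^+ i))).
  by rewrite ler_wpM2r ?IH// addr_ge0.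
rewrite -mulrA ler_wpM2l//.
rewrite (_ : B * (q ^+ j - q ^+ i.+1) / (1 - q) =
  B * (q ^+ j - q ^+ i) / (1 - q) + B * q ^+ i); last first.
  by rewrite exprS; field; rewrite subr_eq0 gt_eqF.
by rewrite expRD ler_wpM2l ?expR_ge0// expR_ge1Dx.
Qed.

(* At time [4 ^ j] jumps are cut at [a ^+ j], which is [n `^ (2 + eps)^-1] for
   [n = 4 ^ j]: both overshoot terms are then of order [(a / 2) ^+ j]. *)
Let a := 4 `^ (2 + eps)^-1 : R.

Let a_pow : a `^ (2 + eps) = 4.
Proof.
rewrite -powRrM mulVf ?powRr1//.
by rewrite gt_eqF// addr_gt0.
Qed.

Let a_gt0 : 0 < a. Proof. by rewrite powR_gt0. Qed.

(** Otherwise 4 would be at least 2 to the power [2 + eps], that is, 4 times 2 to the power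
    [eps]. *)
Let a_lt2 : a < 2.
Proof.
have e2 : 0 < 2 + eps by rewrite addr_gt0.
rewrite ltNge; apply/negP => a2.
have : (2 : R) `^ (2 + eps) <= a `^ (2 + eps).
  by apply: ge0_ler_powR => //; rewrite ?nnegrE// ltW// a_gt0.
rewrite a_pow powRD; last by apply/implyP => _; rewrite gt_eqF.
have := @gt0_ltr_powR R eps eps0 1 2; rewrite powR1 !nnegrE powR_mulrn//.
move=> /(_ ler01 (ler0n _ _) (ltr1n _ 2)) h1 h2; nra.
Qed.

(** This is [overshoot] between consecutive powers of 4 with [L = a ^+ j]. As the power [2 + eps] of
    [L] is [4 ^+ j], the moment bound makes the large jumps cost at most [4 * C * L];
    [survival_le_mean] then turns the survival factor into a multiple of the mean over [2 ^+ j]. *)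
Lemma mean_growth j y : 2 * M <= 2 ^+ j -> 0 <= y ->
  (mean (4 ^ j.+1)%N y <= mean (4 ^ j)%N y *
    (1 + 2 * (c^-1 + 1) * (1 + 4 * C) * (a / 2) ^+ j)%:E)%E.
Proof.
move=> Mj y0; pose L := a ^+ j; have L0 : 0 < L by rewrite exprn_gt0.
have jj : (4 ^ j <= 4 ^ j.+1)%N by rewrite leq_exp2l.
have LP : L `^ (2 + eps) = 4 ^+ j.
  by rewrite /L -powR_mulrn ?ltW// -powRrM mulrC powRrM a_pow powR_mulrn.
have := overshoot ce jj (ltW L0) y0.
have -> : (\sum_(4 ^ j <= k < 4 ^ j.+1) big_part L (law_at k) =
    (\sum_(4 ^ j <= k < 4 ^ j.+1) fine (big_part L (law_at k)))%:E)%E.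
  by rewrite -sumEFin; apply: eq_bigr => k _; rewrite fineK// big_part_fin_num.
set b := \sum_(_ <= k < _) _.
have bL : b <= 4 * C * L.
  rewrite -lee_fin /b -sumEFin.
  apply: (@le_trans _ _ (\sum_(0 <= k < 4 ^ j.+1) big_part L (law_at k))%E).
    rewrite [leRHS](@big_cat_nat _ _ _ (4 ^ j)%N)//=.
    rewrite -[leLHS]add0e; apply: leeD.
      by apply: sume_ge0 => k _; exact: big_part_ge0.
    by apply: lee_sum => k _; rewrite fineK// big_part_fin_num.
  apply: (@le_trans _ _ (\sum_(0 <= k < 4 ^ j.+1) (L / 4 ^+ j)%:E * moment (law_at k))%E).
    by apply: lee_sum => k _; rewrite -LP; exact: big_part_le_moment.
  rewrite -ge0_sume_distrr; last first.
    by move=> k _; apply: integral_ge0 => x _; rewrite lee_fin powR_ge0.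
  apply: (@le_trans _ _ ((L / 4 ^+ j)%:E * (C * (4 ^ j.+1)%:R)%:E)%E).
    by apply: lee_wpmul2l; rewrite ?lee_fin ?divr_ge0 ?exprn_ge0// ltW.
  rewrite -EFinM lee_fin natrX exprS.
  rewrite (_ : L / 4 ^+ j * _ = 4 * C * L)//.
  by field; rewrite expf_neq0.
have := survival_le_mean Mj y0.
have := survival_ge0 e (4 ^ j.+1)%N y; have := survival_ge0 e (4 ^ j)%N y.
have /fineK <- := survival_fin_num e (4 ^ j.+1)%N y0.
have /fineK <- := survival_fin_num e (4 ^ j)%N y0.
have /fineK <- := mean_fin_num ce (4 ^ j)%N y0.
have /fineK <- := mean_fin_num ce (4 ^ j.+1)%N y0.
move: (fine _) (fine _) (fine _) (fine _) => u' u p' p.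
rewrite -!EFinM -!EFinD !lee_fin => p'0 p0 pu H.
rewrite (_ : (a / 2) ^+ j = L / 2 ^+ j); last by rewrite expr_div_n.
move: pu; set K : R := 2 ^+ j => pu.
have Lb : (L + b) * p <= (L + 4 * C * L) * (2 * (c^-1 + 1) / K * u).
  apply: (@le_trans _ _ ((L + 4 * C * L) * p)); first by apply: ler_wpM2r => //; lra.
  apply: ler_wpM2l => //; apply: addr_ge0; first exact: ltW.
  by rewrite !mulr_ge0// ltW.
rewrite (_ : u * _ = u + (L + 4 * C * L) * (2 * (c^-1 + 1) / K * u)).
  have Lp' : 0 <= L * p' by rewrite mulr_ge0// ltW.
  lra.
by field; rewrite !gt_eqF// exprn_gt0.
Qed.

(** The Gronwall product starts at a [j] so late that its exponent is below [ln (1 + delta)]. The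
    crude bound [mean_le] at time [4 ^ j] supplies [D]. Neither [j] nor [D] depends on [y]. *)
Lemma mean_bound (delta : R) : 0 < delta ->
  exists2 D : R, 0 <= D & forall n y, 0 <= y ->
    (mean n y <= ((1 + delta) * (y + D))%:E)%E.
Proof.
move=> d0; pose q := a / 2; pose B := 2 * (c^-1 + 1) * (1 + 4 * C).
have q0 : 0 < q by rewrite divr_gt0.
have q1 : q < 1 by rewrite ltr_pdivrMr// mul1r.
have B0 : 0 <= B.
  by rewrite !mulr_ge0// addr_ge0// ?mulr_ge0// invr_ge0 ltW.
have [j0 Mj0] : exists j0, forall j, (j0 <= j)%N -> 2 * M <= 2 ^+ j.
  exists (Num.bound (2 * M)) => j jj.
  apply: (le_trans (ltW (archi_boundP _))); first by rewrite mulr_ge0// ltW.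
  apply: (@le_trans _ _ j%:R); first by rewrite ler_nat.
  by rewrite -natrX ler_nat ltnW// ltn_expl.
have l0 : 0 < ln (1 + delta) by rewrite ln_gt0// ltrDl.
have [j jj qj] : exists2 j, (j0 <= j)%N & B * q ^+ j / (1 - q) <= ln (1 + delta).
  have q1' : 0 < 1 - q by rewrite subr_gt0.
  have : (fun j => B * q ^+ j / (1 - q)) @ \oo --> B * 0 / (1 - q).
    apply: cvgMl; apply: cvgMr; apply: cvg_expr.
    by rewrite ger0_norm// ltW.
  rewrite mulr0 mul0r => /cvgrPdist_le /(_ _ l0) [N _ H].
  exists (maxn N j0); first exact: leq_maxr.
  have := H (maxn N j0) (leq_maxl _ _); rewrite sub0r normrN.
  exact: le_trans (ler_norm _).
pose n0 := (4 ^ j)%N.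
exists (fine (\sum_(0 <= k < n0) big_part 0 (law_at k))%E).
  by rewrite fine_ge0// sume_ge0// => k _; exact: big_part_ge0.
move=> n y y0.
have Dfin : (\sum_(0 <= k < n0) big_part 0 (law_at k))%E \is a fin_num.
  rewrite (eq_bigr (fun k => (fine (big_part 0 (law_at k)))%:E)) ?sumEFin//.
  by move=> k _; rewrite fineK// big_part_fin_num.
have := mean_le ce n0 y0.
rewrite -{1}(fineK Dfin) -EFinD; set D := fine _ => mD.
(* By monotonicity in time, [n] may be rounded up to [4 ^ i]; the maximum with [j] makes [gronwall]
   applicable. *)
pose i := maxn n j.
have ni : (n <= 4 ^ i)%N.
  by apply: leq_trans (ltnW (ltn_expl i (isT : (1 < 4)%N))); exact: leq_maxl.
apply: (le_trans (mean_nondecreasing ce y0 ni)).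
pose u k := fine (mean (4 ^ k)%N y).
have uE k : mean (4 ^ k)%N y = (u k)%:E by rewrite fineK// mean_fin_num.
have u0 k : 0 <= u k by rewrite fine_ge0// mean_ge0.
have Hu k : (j0 <= k)%N -> u k.+1 <= u k * (1 + B * q ^+ k).
  by move=> jk; rewrite -lee_fin EFinM -!uE; exact: mean_growth (Mj0 _ jk) y0.
have := gronwall B0 q0 q1 u0 Hu jj (leq_maxr n j).
rewrite uE lee_fin => /le_trans; apply.
rewrite mulrC; apply: ler_pM => //.
  rewrite -[leRHS](@lnK _ (1 + delta)) ?posrE ?addr_gt0// ler_expR.
  apply: le_trans qj; rewrite ler_pM2r ?invr_gt0 ?subr_gt0//.
  by rewrite ler_wpM2l// lerBlDr lerDl exprn_ge0// ltW.
by rewrite -lee_fin -uE.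
Qed.

End growth.

(** * From the walk to the killed operators *)

Section independence.
Context (R : realType) (d : measure_display) (Omega : measurableType d).
Context (P : probability Omega R) (X : nat -> {mfun Omega >-> R}).
Hypothesis indep : mutually_independent P X.
Local Open Scope ereal_scope.

(** A pi-system generating the sigma-algebra of the [X i] with [i < n]. *)
Definition past_rectangles n : set (set Omega) :=
  [set B | exists2 A : nat -> set R, (forall i, measurable (A i)) &
    B = \bigcap_(i in [set` iota 0 n]) X i @^-1` A i].

Lemma measurable_preimage_mfun i (A : set R) :
  measurable A -> measurable (X i @^-1` A).
Proof. by move=> mA; rewrite -[X in measurable X]setTI; exact: measurable_funP. Qed.

Lemma past_measurable n (B : set Omega) :
  <<s past_rectangles n >> B -> measurable B.
Proof.
move: B; apply: smallest_sub; first exact: sigma_algebra_measurable.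
move=> _ [A mA ->]; rewrite bigcap_seq.
by apply: bigsetI_measurable => i _; exact: measurable_preimage_mfun.
Qed.

Lemma setI_closed_past n : setI_closed (past_rectangles n).
Proof.
move=> _ _ [A mA ->] [B mB ->]; exists (fun i => A i `&` B i).
  by move=> i; exact: measurableI.
by rewrite -bigcapI; apply: eq_bigcapr => i _; rewrite preimage_setI.
Qed.

(** Pi-lambda argument: independence gives the identity on rectangles, and it passes to complements
    and disjoint unions. *)
Lemma past_independent n (B : set Omega) (A : set R) :
  <<s past_rectangles n >> B -> measurable A ->
  P (B `&` X n @^-1` A) = P B * P (X n @^-1` A).
Proof.
move=> + mA; have mXA := measurable_preimage_mfun n mA.
move: B; apply: (@dynkin_induction _ (g_sigma_algebraType (past_rectangles n))
  (past_rectangles n) (fun B => P (B `&` X n @^-1` A) = P B * P (X n @^-1` A))) => //.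
- exact: setI_closed_past.
- by rewrite setTI probability_setT mul1e.
- move=> _ [B mB ->].
  (* Independence is applied to the rectangle extended by [A] in slot [n]. *)
  pose B' i := if i == n then A else B i.
  have mB' i : measurable (B' i) by rewrite /B'; case: ifP.
  have E i : i \in iota 0 n -> B' i = B i.
    by rewrite mem_iota add0n leq0n /B' => /= /ltn_eqF ->.
  have En : B' n = A by rewrite /B' eqxx.
  have E1 : \bigcap_(i in [set` iota 0 n.+1]) X i @^-1` B' i =
    \bigcap_(i in [set` iota 0 n]) X i @^-1` B i `&` X n @^-1` A.
    rewrite !bigcap_seq -addn1 iotaD big_cat/= big_seq1 En; congr (_ `&` _).
    by apply: eq_big_seq => i iI; rewrite E.
  rewrite -E1 !indep ?iota_uniq// -addn1 iotaD big_cat/= big_seq1 En.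
  by congr (_ * _); apply: eq_big_seq => i iI; rewrite E.
- move=> S mS IH; have {}mS : @measurable d Omega S by exact: (@past_measurable n _ mS).
  (* The same set lives in two measurable structures on [Omega]; the claim is restated in the
     ambient one, on which [P] is defined. *)
  change (P (@setI Omega S (X n @^-1` A)) = P S * P (X n @^-1` A)) in IH.
  change (P (@setI Omega (@setC Omega S) (X n @^-1` A)) =
    P (@setC Omega S) * P (X n @^-1` A)).
  rewrite probability_setC// setIC -setDE measureD//; last by rewrite ltey_eq fin_num_measure.
  transitivity (P (X n @^-1` A) - P S * P (X n @^-1` A)).
    by congr (_ - _); rewrite setIC; exact: IH.
  have SP := fin_num_measure P S mS.
  by rewrite muleBl ?mul1e// ?fin_num_measure// fin_num_adde_defl.
- move=> F mF tF IH; have {}mF k : @measurable d Omega (F k) by exact: (@past_measurable n _ (mF k)).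
  change (P (@setI Omega (\bigcup_k (F k : set Omega)) (X n @^-1` A)) =
    P (\bigcup_k (F k : set Omega)) * P (X n @^-1` A)).
  rewrite setI_bigcupl !measure_bigcup//=; last 2 first.
    by move=> k _; exact: measurableI.
    exact: trivIset_setIr.
  have /fineK <- := fin_num_measure P _ mXA.
  rewrite muleC -nneseriesZl//; apply: eq_eseriesr => k _.
  by rewrite fineK ?fin_num_measure// muleC; exact: IH.
Qed.

Lemma past_X n k (A : set R) : (k < n)%N -> measurable A ->
  <<s past_rectangles n >> (X k @^-1` A).
Proof.
move=> kn mA; apply: sub_gen_smallest.
exists (fun i => if i == k then A else setT).
  by move=> i; case: ifP.
rewrite bigcap_seq (big_rem k)/=; last by rewrite mem_iota.
rewrite eqxx big1_seq ?setIT// => i /=; rewrite rem_filter ?iota_uniq//.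
by rewrite mem_filter => /andP[/negbTE /= -> _]; rewrite preimage_setT.
Qed.

Lemma measurable_walk_past n k : (k <= n)%N ->
  measurable_fun [set: g_sigma_algebraType (past_rectangles n)]
    (walk X k : g_sigma_algebraType (past_rectangles n) -> R).
Proof.
move=> kn; apply: measurable_sum => i _ A mA; rewrite setTI.
by apply: past_X => //; exact: leq_trans kn.
Qed.

(** [Z] depends on the past only, so the law of [(Z, X n)] is the product of its marginals, and
    Tonelli applies. *)
Lemma integral_independent d' (T : measurableType d') n (Z : Omega -> T)
    (F : T * R -> \bar R) :
  measurable_fun [set: g_sigma_algebraType (past_rectangles n)]
    (Z : g_sigma_algebraType (past_rectangles n) -> T) ->
  (forall u, 0 <= F u) -> measurable_fun setT F ->
  \int[P]_x F (Z x, X n x) =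
  \int[P]_x \int[distribution P (X n)]_t F (Z x, t).
Proof.
move=> mZ F0 mF.
have mZ' : measurable_fun setT Z.
  move=> _ A mA; rewrite setTI; apply: (@past_measurable n).
  by have := mZ measurableT A mA; rewrite setTI.
have mZX : measurable_fun setT (fun x => (Z x, X n x)).
  exact: measurable_fun_pair.
pose Zm : {mfun Omega >-> T} := HB.pack Z (isMeasurableFun.Build _ _ _ _ _ mZ').
pose W : {mfun Omega >-> (T * R)%type} :=
  HB.pack (fun x => (Z x, X n x)) (isMeasurableFun.Build _ _ _ _ _ mZX).
transitivity (\int[distribution P W]_u F u).
  by rewrite ge0_integral_distribution.
transitivity (\int[(distribution P Zm \x distribution P (X n))%E]_u F u).
  apply: eq_measure_integral => A mA _; apply/esym.
  apply: product_measure_unique => //  B C mB mC.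
  rewrite /distribution /pushforward/=.
  rewrite -past_independent//; last first.
    by have := mZ measurableT B mB; rewrite setTI.
rewrite fubini_tonelli1// ge0_integral_distribution//.
  exact: measurable_fun_fubini_tonelli_F.
by move=> t; exact: integral_ge0.
Qed.

End independence.

(** * Measurability of pointwise limits *)

Section measurable_limn.
Context d (T : measurableType d) (R : realType).
Implicit Type f : (T -> \bar R)^nat.
Local Open Scope ereal_scope.

Lemma limn_einf_sup_cvg (u : (\bar R)^nat) :
  limn_einf u = limn_esup u -> u @ \oo --> limn_esup u.
Proof.
move=> E; apply: (@squeeze_cvge _ _ _ _ (einfs u) _ (esups u)).
- apply: nearW => n; apply/andP; split.
    by apply: ereal_inf_lbound; exists n => //=.
  by apply: ereal_sup_ubound; exists n => //=.
- by rewrite -E limn_einf_lim; exact: is_cvg_einfs.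
- by rewrite limn_esup_lim; exact: is_cvg_esups.
Qed.

(* No convergence is assumed: off the set where the lower and upper limits
   agree, [limn] is the default value [point]. *)
Lemma measurable_fun_limn f : (forall n, measurable_fun setT (f n)) ->
  measurable_fun setT (fun t => limn (f ^~ t)).
Proof.
move=> mf.
have ms : measurable_fun setT (fun t => limn_esup (f ^~ t)).
  exact: measurable_fun_limn_esup.
have mi : measurable_fun setT (fun t => limn_einf (f ^~ t)).
  apply: measurableT_comp => //.
  by apply: measurable_fun_limn_esup => n; exact: measurableT_comp.
rewrite [X in measurable_fun _ X](_ : _ = fun t =>
    if limn_einf (f ^~ t) == limn_esup (f ^~ t) then limn_esup (f ^~ t)
    else point); last first.
  apply/funext => t; case: ifPn => [/eqP/limn_einf_sup_cvg/cvg_lim -> //|ne].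
  rewrite /lim /lim_in getPN// => l fl; move/eqP: ne; apply.
  by have [-> ->] := cvg_limn_einf_sup fl.
apply: measurable_fun_ifT => //.
exact: measurable_fun_eqe.
Qed.

End measurable_limn.

(** * The quenched walk as a killed iterate, and the basic properties of [U] *)

Section quenched_mean.
Context (R : realType) (d : measure_display) (Omega : measurableType d).
Context (Q : environment R -> probability Omega R).
Context (X : nat -> {mfun Omega >-> R}).
Hypothesis X_quenched : quenched_increments Q X.
Local Open Scope ereal_scope.

(** The event [n < tau] in a form visibly decided by the first [n] increments. *)
Fixpoint alive (n : nat) (y : R) (x : Omega) : bool :=
  if n is m.+1 then alive m y x && (0 < y + walk X m.+1 x)%R else true.

Lemma walk0 x : walk X 0 x = 0%R. Proof. by rewrite /walk big_ord0. Qed.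

Lemma walkS n x : walk X n.+1 x = (walk X n x + X n x)%R.
Proof. by rewrite /walk big_ord_recr. Qed.

Lemma aliveP n y x :
  reflect (forall k, (0 < k <= n)%N -> (0 < y + walk X k x)%R) (alive n y x).
Proof.
elim: n => [|n IH] /=.
  by apply: ReflectT => k /andP[]; rewrite leqn0 => /[swap] /eqP ->.
apply: (iffP andP) => [[/IH An yn] k /andP[k0]|H].
  by rewrite leq_eqVlt => /predU1P[-> //|]; rewrite ltnS => kn; apply: An; rewrite k0.
split; last by apply: H; rewrite /= leqnn.
by apply/IH => k /andP[k0 kn]; apply: H; rewrite k0 ltnW.
Qed.

Lemma lt_tau n y x : (n%:R%:E < tau X y x) = alive n y x.
Proof.
apply/idP/aliveP => [nt k /andP[k0 kn]|H].
  rewrite ltNge; apply/negP => yk.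
  have : tau X y x <= k%:R%:E by apply: ereal_inf_lbound; exists k.
  by rewrite leNgt => /negP; apply; apply: le_lt_trans nt; rewrite lee_fin ler_nat.
(* The exit times are integers beyond [n], so their infimum is at least [n.+1]; this keeps the
   inequality strict and covers the empty set. *)
apply: (@lt_le_trans _ _ n.+1%:R%:E); first by rewrite lte_fin ltr_nat.
apply: le_ereal_inf_tmp => _ [k [k0 yk] <-]; rewrite lee_fin ler_nat ltnNge.
apply/negP => kn; have := H k; rewrite k0 kn => /(_ isT).
by rewrite ltNge yk.
Qed.

Lemma in_tau n y x :
  (x \in [set x | n%:R%:E < tau X y x]) = alive n y x.
Proof. by rewrite -lt_tau; apply/idP/idP; rewrite inE. Qed.

Lemma measurable_walk_past_shift n k y : (k <= n)%N ->
  measurable_fun [set: g_sigma_algebraType (past_rectangles X n)]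
    (fun x : g_sigma_algebraType (past_rectangles X n) => (y + walk X k x)%R).
Proof. by move=> kn; apply: measurable_funD => //; exact: measurable_walk_past. Qed.

Lemma measurable_alive_past n y m : (m <= n)%N ->
  measurable_fun [set: g_sigma_algebraType (past_rectangles X n)]
    (alive m y : g_sigma_algebraType (past_rectangles X n) -> bool).
Proof.
elim: m => [|m IH] mn /=; first exact: measurable_cst.
apply: measurable_and; first by apply: IH; exact: ltnW.
apply: measurable_fun_ltr => //.
exact: (@measurable_walk_past_shift n m.+1 y mn).
Qed.

(** Markov property: the last increment is independent of the survival flag and the position at time
    [n]. Integrating it out applies [step (e n)], as in [killedSr]. *)
Lemma integral_alive n e g y : (forall z, 0 <= g z) -> measurable_fun setT g ->
  \int[Q e]_x (if alive n y x then g (y + walk X n x)%R else 0) = killed n e g y.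
Proof.
move=> g0 mg; elim: n g g0 mg => [|n IH] g g0 mg.
  rewrite /=; under eq_integral do rewrite walk0 addr0.
  rewrite integral_cst//; transitivity (g y * 1); last by rewrite mule1.
  by congr (_ * _); exact: probability_setT.
rewrite killedSr -IH; last 2 first.
- exact: step_ge0.
- exact: measurable_step.
have [indep law_e] := X_quenched e.
pose F (u : (bool * R) * R) : \bar R :=
  if u.1.1 then kill g (u.1.2 + u.2)%R else 0.
have F0 u : 0 <= F u by rewrite /F; case: ifP => // _; exact: kill_ge0.
have mF : measurable_fun setT F.
  apply: measurable_fun_ifT => //.
    by apply: measurableT_comp => //.
  apply: (measurableT_comp (measurable_kill mg)); apply: measurable_funD => //.
  by apply: measurableT_comp => //.
pose Z x := (alive n y x, (y + walk X n x)%R).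
have mZ : measurable_fun [set: g_sigma_algebraType (past_rectangles X n)]
    (Z : g_sigma_algebraType (past_rectangles X n) -> bool * R).
  apply: measurable_fun_pair.
    exact: measurable_alive_past.
  exact: measurable_walk_past_shift.
have := integral_independent indep mZ F0 mF.
rewrite /F /Z /= => E.
transitivity (\int[Q e]_x (if alive n y x then kill g (y + walk X n x + X n x)%R else 0)).
  apply: eq_integral => x _; rewrite /= walkS addrA /kill.
  by case: (alive n y x).
rewrite E; apply: eq_integral => x _; case: (alive n y x); last exact: integral0.
by apply: eq_measure_integral => A mA _; exact: law_e.
Qed.

(** On survival the position is positive, or equal to [y] when [n = 0], so [ppart] changes
    nothing. *)
Lemma UnE n e y : (0 <= y)%R -> Un Q X n e y = killed n e (@ppart R) y.
Proof.
move=> y0; rewrite -(integral_alive _ _ _ (@ppart_ge0 R) (@measurable_ppart R)).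
rewrite /Un /quenched_on integral_mkcond; apply: eq_integral => x _.
rewrite patchE in_tau; case: ifPn => // /aliveP A.
rewrite /ppart max_l//; case: n A => [|n] A; first by rewrite walk0 addr0.
by apply: ltW; apply: A; rewrite /= leqnn.
Qed.

Lemma UE e y : (0 <= y)%R -> U Q X e y = limn (fun n => killed n e (@ppart R) y).
Proof. by move=> y0; rewrite /U; under eq_fun do rewrite UnE//. Qed.

Lemma cvg_U e y : (forall k, centered (e k : probability R R)) -> (0 <= y)%R ->
  killed n e (@ppart R) y @[n --> \oo] --> U Q X e y.
Proof.
move=> ce y0; rewrite UE//; apply: ereal_nondecreasing_is_cvgn.
exact: mean_nondecreasing.
Qed.

Lemma killed_le_U e n y : (forall k, centered (e k : probability R R)) ->
  (0 <= y)%R -> killed n e (@ppart R) y <= U Q X e y.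
Proof.
move=> ce y0; rewrite UE//; apply: lime_ge.
  by apply/cvg_ex; exists (U Q X e y); exact: cvg_U.
by exists n => // m /= nm; exact: mean_nondecreasing.
Qed.

Lemma U_le e y c : (forall k, centered (e k : probability R R)) ->
  (0 <= y)%R -> (forall n, killed n e (@ppart R) y <= c) -> U Q X e y <= c.
Proof.
move=> ce y0 H; rewrite UE//; apply: lime_le; last exact: nearW.
by apply/cvg_ex; exists (U Q X e y); exact: cvg_U.
Qed.

(** With the same increments, a higher starting point survives whenever a lower one does. *)
Lemma U_nondecreasing e y z : (forall k, centered (e k : probability R R)) ->
  (0 <= y)%R -> (y <= z)%R -> U Q X e y <= U Q X e z.
Proof.
move=> ce y0 yz; have z0 := le_trans y0 yz.
apply: U_le => // n; apply: le_trans (killed_le_U n ce z0).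
elim: n e {ce} y y0 z yz z0 => [|n IH] e y y0 z yz z0 /=.
  by rewrite /ppart !max_l.
have p0 := killed_ge0 n (theta e) (@ppart_ge0 R).
have mp := measurable_killed n (theta e) (@ppart_ge0 R) (@measurable_ppart R).
apply: ge0_le_integral => //.
- by move=> x _; exact: kill_ge0.
- exact: measurable_kill_shift.
- exact: measurable_kill_shift.
- move=> x _; rewrite /kill; case: ifP => yx.
    have yxz : (y + x <= z + x)%R by rewrite lerD2r.
    by rewrite (lt_le_trans yx yxz) IH// ltW// (lt_le_trans yx yxz).
  by case: ifP.
Qed.

(** The first step is split off before the limit; monotone convergence then applies because the
    means increase with [n]. *)
Lemma U_harmonic e y : (forall k, centered (e k : probability R R)) ->
  (0 <= y)%R ->
  U Q X e y = quenched_on Q e (fun x => U Q X (theta e) (y + walk X 1 x))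
    [set x | 1%:E < tau X y x].
Proof.
move=> ce y0; have ct k : centered (theta e k : probability R R) by exact: ce.
have p0 n := killed_ge0 n (theta e) (@ppart_ge0 R).
have mp n := measurable_killed n (theta e) (@ppart_ge0 R) (@measurable_ppart R).
have cvgk z : kill (killed n (theta e) (@ppart R)) z @[n --> \oo] -->
    kill (U Q X (theta e)) z.
  by rewrite /kill; case: ltP => z0; [apply: cvg_U => //; exact: ltW|exact: cvg_cst].
have mk : measurable_fun setT (kill (U Q X (theta e))).
  apply: (emeasurable_fun_cvg (fun n => kill (killed n (theta e) (@ppart R)))).
    by move=> n; exact: measurable_kill.
  by move=> z _; exact: cvgk.
have k0 z : 0 <= kill (U Q X (theta e)) z.
  rewrite /kill; case: ifP => // z0; apply: le_trans (killed_le_U 0 ct (ltW z0)).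
  exact: ppart_ge0.
have -> : U Q X e y = step (e 0%N : probability R R) (U Q X (theta e)) y.
  have := cvg_U ce y0; rewrite -cvg_shiftS => /cvg_lim <- //; rewrite /step /=.
  rewrite -(_ : \int[e 0%N]_x limn (fun n => kill (killed n (theta e) (@ppart R)) (y + x)) =
     \int[e 0%N]_x kill (U Q X (theta e)) (y + x)); last first.
    by apply: eq_integral => x _; apply/cvg_lim => //; exact: cvgk.
  rewrite monotone_convergence//.
  - by move=> n; exact: measurable_kill_shift.
  - by move=> n x _; exact: kill_ge0.
  - move=> x _ m n mn; rewrite /kill; case: ifP => // yx.
    by apply: mean_nondecreasing => //; exact: ltW.
have [_ law_e] := X_quenched e.
transitivity (\int[distribution (Q e) (X 0%N)]_t kill (U Q X (theta e)) (y + t)).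
  by apply/esym; apply: eq_measure_integral => A mA _; exact: law_e.
rewrite ge0_integral_distribution//; last first.
  by apply: (measurableT_comp mk); exact: measurable_funD.
rewrite /quenched_on [RHS]integral_mkcond; apply: eq_integral => x _.
rewrite patchE (in_tau 1) /= walkS walk0 add0r.
by rewrite /kill /=; case: ifP.
Qed.

Lemma measurable_U y : (0 <= y)%R ->
  measurable_fun [set: env_space R] (fun e : env_space R => U Q X e y).
Proof.
move=> y0; have -> : (fun e : env_space R => U Q X e y) =
    (fun e => limn (fun n => killed n e (@ppart R) y)).
  by apply/funext => e; exact: UE.
apply: (@measurable_fun_limn _ (env_space R) R
  (fun n (e : env_space R) => killed n e (@ppart R) y)) => n.
have mn := measurable_killed2 n (@ppart_ge0 R) (@measurable_ppart R).
exact: (measurableT_comp mn (pair2_measurable y)).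
Qed.

End quenched_mean.

(** * Maximal ergodic inequality *)

Lemma measurable_ltr_set (R : realType) d (T : measurableType d) (f g : T -> R) :
  measurable_fun setT f -> measurable_fun setT g ->
  measurable [set x | f x < g x].
Proof.
move=> mf mg; have := measurable_fun_ltr mf mg measurableT.
by move=> /(_ [set true] I); rewrite setTI.
Qed.

Section maximal_ergodic.
Context (R : realType) d (T : measurableType d) (mu : probability T R).
Context (th : T -> T).
Hypothesis mth : measurable_fun setT th.
Hypothesis th_inv : forall A, measurable A -> mu (th @^-1` A) = mu A.

Lemma integral_invariant (f : T -> \bar R) : (forall x, 0 <= f x)%E ->
  measurable_fun setT f -> (\int[mu]_x f (th x) = \int[mu]_x f x)%E.
Proof.
move=> f0 mf.
pose thm : {mfun T >-> T} := HB.pack th (isMeasurableFun.Build _ _ _ _ _ mth).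
transitivity (\int[distribution mu thm]_x f x)%E.
  by rewrite ge0_integral_distribution.
by apply: eq_measure_integral => A mA _; exact: th_inv.
Qed.

Lemma measurable_iter k : measurable_fun setT (iter k th).
Proof. by elim: k => [|k IH]; [exact: measurable_id|exact: (measurableT_comp mth IH)]. Qed.

(** By invariance the preimages of a null set under the iterates are null, and there are countably
    many. *)
Lemma ae_iter (A : set T) : measurable A -> mu A = 0%E ->
  {ae mu, forall x, forall k, ~ A (iter k th x)}.
Proof.
move=> mA A0; apply/ae_foralln => k.
have mk j : measurable (iter j th @^-1` A).
  by rewrite -[X in measurable X]setTI; exact: (measurable_iter j measurableT mA).
exists (iter k th @^-1` A); split => //; last first.
  by move=> x /= nA; apply: contrapT => H; apply: nA.
elim: k => [//|k IH].
rewrite (_ : iter k.+1 th @^-1` A = th @^-1` (iter k th @^-1` A)).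
  by apply: etrans IH; exact: th_inv.
by apply/seteqP; split => x /=; rewrite -iterS iterSr.
Qed.

Section maximal_inequality.
Variables (f : T -> R) (l : R).
Hypothesis f0 : forall x, 0 <= f x.
Hypothesis mf : measurable_fun setT f.
Hypothesis l0 : 0 < l.
Hypothesis intf : (\int[mu]_x (f x)%:E < +oo)%E.

(** The maximum over [0 <= k <= n] of the sum of [f - l] along the first [k] points of the orbit. *)
Fixpoint max_sum (n : nat) (x : T) : R :=
  if n is m.+1 then Num.max 0 (f x - l + max_sum m (th x)) else 0.

Lemma max_sum_ge0 n x : 0 <= max_sum n x.
Proof. by case: n => [//|n] /=; rewrite le_max lexx. Qed.

Lemma measurable_max_sum n : measurable_fun setT (max_sum n).
Proof.
elim: n => [|n IH] /=; first exact: measurable_cst.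
apply: measurable_maxr => //; apply: measurable_funD.
  exact: measurable_funB.
exact: measurableT_comp.
Qed.

Lemma max_sum_le_succ n x : max_sum n x <= max_sum n.+1 x.
Proof.
elim: n x => [|n IH] x; first exact: max_sum_ge0.
rewrite -[leLHS]/(Num.max 0 (f x - l + max_sum n (th x))).
rewrite -[leRHS]/(Num.max 0 (f x - l + max_sum n.+1 (th x))).
by rewrite ge_max !le_max lexx/= lerD2l IH orbT.
Qed.

Lemma sum_le_max_sum n x :
  \sum_(k < n) f (iter k th x) - l * n%:R <= max_sum n x.
Proof.
elim: n x => [|n IH] x; first by rewrite big_ord0 mulr0 subr0.
rewrite big_ord_recl /= le_max; apply/orP; right.
have -> : \sum_(i < n) f (iter (bump 0 i) th x) = \sum_(i < n) f (iter i th (th x)).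
  by apply: eq_bigr => k _; rewrite /bump leq0n add1n iterSr.
have := IH (th x); rewrite -natr1; lra.
Qed.

(** Finiteness allows the cancellation in [maximal_inequality_fin]. *)
Lemma integral_max_sum_lty n : (\int[mu]_x (max_sum n x)%:E < +oo)%E.
Proof.
elim: n => [|n IH]; first by rewrite integral0.
have mM m : measurable_fun setT (fun x => (max_sum m x)%:E).
  by apply/measurable_EFinP; exact: measurable_max_sum.
have M0 m x : setT x -> (0 <= (max_sum m x)%:E)%E by rewrite lee_fin max_sum_ge0.
have mf' : measurable_fun setT (fun x => (f x)%:E) by exact/measurable_EFinP.
have mMt : measurable_fun setT (fun x => (max_sum n (th x))%:E).
  exact: (measurableT_comp (mM n)).
apply: (@le_lt_trans _ _ (\int[mu]_x ((f x)%:E + (max_sum n (th x))%:E))%E).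
  apply: ge0_le_integral => //.
  - exact: M0.
  - exact: emeasurable_funD.
  - move=> x _; rewrite -EFinD lee_fin /= ge_max.
    by rewrite addr_ge0 ?max_sum_ge0//= lerD2r gerBl ltW.
have M0t x : setT x -> (0 <= (max_sum n (th x))%:E)%E by rewrite lee_fin max_sum_ge0.
have f0' x : setT x -> (0 <= (f x)%:E)%E by rewrite lee_fin.
rewrite (ge0_integralD mu measurableT f0' mf' M0t mMt) lte_add_pinfty//.
rewrite (integral_invariant (f := fun x => (max_sum n x)%:E))// => x.
by rewrite lee_fin max_sum_ge0.
Qed.

(* Garsia's argument: [max_sum n.+1 + l * 1_(0 < max_sum n.+1) <= f + max_sum n.+1 \o th]
   pointwise, and the two integrals of [max_sum n.+1] cancel by invariance. *)
Lemma maximal_inequality_fin n :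
  (l%:E * mu [set x | 0 < max_sum n.+1 x]%R <= \int[mu]_x (f x)%:E)%E.
Proof.
set A := [set x | 0 < max_sum n.+1 x].
have mM m : measurable_fun setT (fun x => (max_sum m x)%:E).
  by apply/measurable_EFinP; exact: measurable_max_sum.
have M0 m x : setT x -> (0 <= (max_sum m x)%:E)%E by rewrite lee_fin max_sum_ge0.
have mf' : measurable_fun setT (fun x => (f x)%:E) by exact/measurable_EFinP.
have mMt : measurable_fun setT (fun x => (max_sum n.+1 (th x))%:E).
  exact: (measurableT_comp (mM n.+1)).
have mA : measurable A.
  by apply: measurable_ltr_set => //; exact: measurable_max_sum.
have mI : measurable_fun setT (fun x => (\1_A x)%:E : \bar R).
  exact/measurable_EFinP/measurable_indic.
have Mfin : (\int[mu]_x (max_sum n.+1 x)%:E \is a fin_num)%E.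
  by rewrite ge0_fin_numE ?integral_max_sum_lty//; apply: integral_ge0 => x; exact: M0.
rewrite -(leeD2lE _ _ Mfin).
have M0t x : setT x -> (0 <= (max_sum n.+1 (th x))%:E)%E by rewrite lee_fin max_sum_ge0.
have f0' x : setT x -> (0 <= (f x)%:E)%E by rewrite lee_fin.
have I0 x : setT x -> (0 <= (\1_A x)%:E :> \bar R)%E by rewrite lee_fin.
have l0' : (0 <= l%:E)%E by rewrite lee_fin ltW.
have lI0 x : setT x -> (0 <= l%:E * (\1_A x)%:E)%E by move=> ?; rewrite mule_ge0 ?I0.
have mlI : measurable_fun setT (fun x => l%:E * (\1_A x)%:E)%E.
  exact: emeasurable_funM.
rewrite -[A]setIT -(integral_indic mu measurableT mA).
rewrite -(ge0_integralZl mu measurableT mI I0 l0').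
rewrite -(ge0_integralD mu measurableT (M0 n.+1) (mM n.+1) lI0 mlI).
rewrite -[X in (_ <= X + _)%E](integral_invariant (f := fun x => (max_sum n.+1 x)%:E))//;
  last by move=> x; exact: M0.
rewrite -(ge0_integralD mu measurableT M0t mMt f0' mf').
apply: ge0_le_integral => //.
- move=> x _; rewrite adde_ge0 ?lee_fin ?max_sum_ge0// mulr_ge0// ltW//.
- by apply: emeasurable_funD => //; exact: emeasurable_funM.
- exact: emeasurable_funD.
move=> x _; rewrite -EFinM -!EFinD lee_fin indicE.
have Mt := max_sum_ge0 n.+1 (th x); have fx := f0 x.
have [|nA] := boolP (x \in A).
  rewrite inE /A /= lt_max ltxx/= => pos; rewrite max_r ?(ltW pos)// mulr1.
  have := max_sum_le_succ n (th x); rewrite /=; lra.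
rewrite mulr0 addr0; have -> : max_sum n.+1 x = 0.
  apply: le_anti; rewrite max_sum_ge0 andbT leNgt.
  by apply: contra nA => pos; rewrite inE.
by rewrite addr_ge0.
Qed.

(** [B] is where some [max_sum] is positive; the bound reaches this increasing union by continuity
    from below. *)
Lemma maximal_inequality : exists B : set T, [/\ measurable B,
  (l%:E * mu B <= \int[mu]_x (f x)%:E)%E &
  forall x, ~ B x -> forall n, \sum_(k < n) f (iter k th x) <= l * n%:R].
Proof.
pose F n := [set x | 0 < max_sum n x].
have mF n : measurable (F n).
  by apply: measurable_ltr_set => //; exact: measurable_max_sum.
have mB : measurable (\bigcup_n F n) by exact: bigcupT_measurable.
exists (\bigcup_n F n); split => //.
- have ndF : nondecreasing_seq F.
    apply/nondecreasing_seqP => n; apply/subsetPset => x.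
    by rewrite /F /= => /lt_le_trans; apply; exact: max_sum_le_succ.
  have cF := cvgeZl (isT : l%:E \is a fin_num) (nondecreasing_cvg_mu (mu := mu) mF mB ndF).
  rewrite -(cvg_lim _ cF)//; apply: lime_le; first by apply/cvg_ex; eexists; exact: cF.
  exists 1%N => // -[//|n] _.
  exact: maximal_inequality_fin.
- move=> x nB n; have := sum_le_max_sum n x.
  suff -> : max_sum n x = 0 by rewrite subr_le0.
  apply: le_anti; rewrite max_sum_ge0 andbT leNgt; apply/negP => pos.
  by apply: nB; exists n.
Qed.

End maximal_inequality.

Lemma null_bigcap (B : nat -> set T) (u : nat -> \bar R) :
  (forall n, measurable (B n)) -> (forall n, mu (B n) <= u n)%E ->
  u @ \oo --> 0%E -> mu (\bigcap_n B n) = 0%E.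
Proof.
move=> mB Bu u0; apply: le_anti; rewrite measure_ge0 andbT.
rewrite -(cvg_lim _ u0)//; apply: lime_ge; first by apply/cvg_ex; eexists; exact: u0.
apply: nearW => n; apply: le_trans (Bu n).
apply: le_measure; rewrite ?inE//; first exact: bigcapT_measurable.
exact: bigcap_inf.
Qed.

(** A point without a constant lies in the exceptional set of every level [m.+1], whose measure is
    at most the integral of [f] divided by [m.+1]. *)
Lemma ae_sum_le (f : T -> R) : (forall x, 0 <= f x) -> measurable_fun setT f ->
  (\int[mu]_x (f x)%:E < +oo)%E ->
  {ae mu, forall x, exists2 C, 0 <= C &
    forall n, \sum_(k < n) f (iter k th x) <= C * n%:R}.
Proof.
move=> f0 mf intf.
have l0 m : 0 < m.+1%:R :> R by rewrite ltr0n.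
have /choice[B HB] m := maximal_inequality f0 mf (l0 m) intf.
exists (\bigcap_m B m); split.
- by apply: bigcapT_measurable => m; have [] := HB m.
- pose I := fine (\int[mu]_x (f x)%:E)%E.
  have IE : (\int[mu]_x (f x)%:E = I%:E)%E.
    by rewrite fineK// ge0_fin_numE//; apply: integral_ge0 => x _; rewrite lee_fin.
  apply: (@null_bigcap _ (fun m => (I * harmonic m)%:E)).
  + by move=> m; have [] := HB m.
  + move=> m; have [mB + _] := HB m; rewrite IE.
    have /fineK <- := fin_num_measure mu (B m) mB.
    by rewrite -EFinM !lee_fin /harmonic/= ler_pdivlMr// mulrC.
  + apply: cvg_EFin; first exact: nearW.
    rewrite -[X in _ --> X](mulr0 I); apply: cvgMr; exact: cvg_harmonic.
- move=> x /= nx m _; apply: contrapT => nB; apply: nx.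
  exists m.+1%:R => //.
  by have [_ _] := HB m; exact.
Qed.

(** The sets [D m] where [g m] is below [m.+1%:R^-1] decrease to a null set. By the maximal
    inequality at level 1/2 for their indicators, the orbit spends at most half of its time in
    [D m], except on a set of measure at most [2 * mu (D m)]. *)
Lemma ae_sum_ge (g : nat -> T -> R) : (forall m x, 0 <= g m x) ->
  (forall m, measurable_fun setT (g m)) ->
  (forall x, {homo g ^~ x : m n / (m <= n)%N >-> m <= n}) ->
  mu [set x | forall m, g m x < m.+1%:R^-1] = 0%E ->
  {ae mu, forall x, exists m, exists2 c, 0 < c &
    forall n, c * n%:R <= \sum_(k < n) g m (iter k th x)}.
Proof.
move=> g0 mg ndg gnull.
pose D m := [set x | g m x < m.+1%:R^-1].
have mD m : measurable (D m).
  exact: measurable_ltr_set.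
have h0 : 0 < 2^-1 :> R by rewrite invr_gt0.
have iD m : (\int[mu]_x (\1_(D m) x)%:E = mu (D m))%E.
  by rewrite integral_indic// setIT.
have /choice[B HB] m : exists B, [/\ measurable B,
    ((2^-1)%:E * mu B <= \int[mu]_x (\1_(D m) x)%:E)%E &
    forall x, ~ B x -> forall n,
      \sum_(k < n) \1_(D m) (iter k th x) <= 2^-1 * n%:R :> R].
  apply: maximal_inequality => //.
  by rewrite iD ltey_eq fin_num_measure.
exists (\bigcap_m B m); split.
- by apply: bigcapT_measurable => m; have [] := HB m.
- apply: (@null_bigcap _ (fun m => 2%:E * mu (D m))%E).
  + by move=> m; have [] := HB m.
  + move=> m; have [mB + _] := HB m; rewrite iD.
    have /fineK <- := fin_num_measure mu (B m) mB.
    have /fineK <- := fin_num_measure mu (D m) (mD m).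
    rewrite -!EFinM !lee_fin; lra.
  + rewrite -(mule0 2%:E); apply: (cvgeZl (isT : 2%:E \is a fin_num)).
    rewrite -gnull (_ : [set _ | _] = \bigcap_m D m); last first.
      by apply/seteqP; split => x /= H m; [move=> _; exact: H|exact: (H m)].
    apply: nonincreasing_cvg_mu => //.
    * by rewrite ltey_eq fin_num_measure.
    * exact: bigcapT_measurable.
    * apply/nonincreasing_seqP => m; apply/subsetPset => x; rewrite /D /= => H.
      apply: (le_lt_trans (ndg x m m.+1 (leqnSn m))); apply: (lt_le_trans H).
      by rewrite lef_pV2 ?posrE// ler_nat.
- move=> x /= nx m _; apply: contrapT => nB; apply: nx.
  (* At least half of the orbit points lie outside [D m], and each of them contributes at least
     [m.+1%:R^-1]. *)
  exists m; exists (m.+1%:R^-1 / 2); first by rewrite divr_gt0.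
  move=> n; have [_ _ /(_ x nB n) Hn] := HB m.
  have i0 : 0 < m.+1%:R^-1 :> R by rewrite invr_gt0.
  apply: (@le_trans _ _ (\sum_(k < n) m.+1%:R^-1 * (1 - \1_(D m) (iter k th x)))).
    rewrite -mulr_sumr big_split/= sumrN sumr_const card_ord -mulrA.
    rewrite ler_pM2l// mulr_natr; move: Hn; rewrite -[n%:R]/(1 *+ n); lra.
  apply: ler_sum => k _; rewrite indicE; have [_|nD] := boolP (_ \in _).
    by rewrite subrr mulr0.
  rewrite subr0 mulr1 leNgt; apply: contra nD => H; by rewrite inE.
Qed.

End maximal_ergodic.

(** * Good environments *)

Section good_environment.
Context (R : realType) (eps : R).
Implicit Types (e : environment R) (m : law R).

(** Deterministic conditions on a single environment from which positivity, harmonicity and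
    asymptotics follow; [ae_good] shows that they hold almost surely. *)
Definition good e :=
  (forall k, centered (e k : probability R R)) /\
  (exists2 C, 0 <= C & forall n,
     (\sum_(0 <= k < n) moment eps (e k : probability R R) <= (C * n%:R)%:E)%E) /\
  (exists M, exists c, [/\ 0 < M, 0 < c & forall n,
     ((c * n%:R)%:E <= \sum_(0 <= k < n) small_part M (e k : probability R R))%E]).

(** * Finiteness, positivity and asymptotics of [U] in a good environment *)

Section conclusion.
Context (d : measure_display) (Omega : measurableType d).
Context (Q : environment R -> probability Omega R).
Context (X : nat -> {mfun Omega >-> R}).
Hypothesis X_quenched : quenched_increments Q X.
Hypothesis eps0 : 0 < eps.
Variable e : environment R.
Hypothesis ge : good e.

Let ce : forall k, centered (e k : probability R R). Proof. exact: ge.1. Qed.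

Lemma U_bound (delta : R) : 0 < delta -> exists2 D : R, 0 <= D &
  forall y, 0 <= y -> (U Q X e y <= ((1 + delta) * (y + D))%:E)%E.
Proof.
move=> d0; have [_ [[C C0 HC] [M [c [M0 c0 Hc]]]]] := ge.
have [D D0 HD] := mean_bound eps0 ce C0 c0 M0 HC Hc d0.
by exists D => // y y0; apply: U_le => // n; exact: HD.
Qed.

Lemma le_U y : 0 <= y -> (y%:E <= U Q X e y)%E.
Proof.
by move=> y0; have := killed_le_U X_quenched 0 ce y0; rewrite /= ppartE.
Qed.

Lemma U_fin_num y : 0 <= y -> (U Q X e y \is a fin_num)%E.
Proof.
move=> y0; have [D _ HD] := U_bound ltr01.
rewrite ge0_fin_numE; first exact: le_lt_trans (HD _ y0) (ltry _).
by apply: le_trans (le_U y0); rewrite lee_fin.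
Qed.

(** By monotonicity [y = 0] is the worst case, and one step from 0 suffices: [x ^+ 2 <= M * x] on
    [0 < x <= M], so a positive [small_part M] forces a positive mean. *)
Lemma U_gt0 y : 0 <= y -> (0 < U Q X e y)%E.
Proof.
move=> y0; apply: (lt_le_trans _ (U_nondecreasing X_quenched ce (lexx 0) y0)).
apply: (lt_le_trans _ (killed_le_U X_quenched 1 ce (lexx 0))).
have [_ [_ [M [c [M0 c0 Hc]]]]] := ge.
have := Hc 1%N; rewrite big_nat1 mulr1 => cs.
have : (small_part M (e 0%N : probability R R) <=
    M%:E * step (e 0%N : probability R R) (@ppart R) 0)%E.
  have p0 := @ppart_ge0 R; have mp := @measurable_ppart R.
  rewrite -(stepZ _ _ p0 mp); last by rewrite lee_fin ltW.
  apply: ge0_le_integral => //.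
  - by move=> x _; rewrite lee_fin; case: ifP => // _; exact: sqr_ge0.
  - by apply/measurable_EFinP; exact: measurable_small_fun.
  - by apply: measurable_kill_shift; exact: emeasurable_funM.
  - move=> x _; rewrite /kill add0r; case: (ltP 0 x) => //= x0.
    rewrite (ppartE (ltW x0)) -EFinM lee_fin; case: ifP => [xM|_].
      by rewrite expr2 ler_pM2r.
    by rewrite mulr_ge0// ltW.
move=> H; rewrite lt0e; apply/andP; split.
  apply/eqP => /= E; move: H; rewrite E mule0 => /(le_trans cs).
  by rewrite lee_fin leNgt c0.
by apply: step_ge0; exact: ppart_ge0.
Qed.

Lemma cvg_U_div : (U Q X e y / y%:E)%E @[y --> +oo] --> 1%:E.
Proof.
have UE y : 0 < y -> (U Q X e y / y%:E)%E = (fine (U Q X e y) / y)%:E.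
  by move=> y0; rewrite -{1}(fineK (U_fin_num (ltW y0))) inver gt_eqF.
apply: cvg_EFin.
  near=> y; have y0 : 0 < y by near: y; apply: nbhs_pinfty_gt; exact: num_real.
  by rewrite UE.
apply/cvgrPdist_le => /= delta d0.
have d2 : 0 < delta / 2 by rewrite divr_gt0.
have [D D0 HD] := U_bound d2.
near=> y; have y0 : 0 < y by near: y; apply: nbhs_pinfty_gt; exact: num_real.
(* Beyond this threshold [(1 + delta / 2) * (y + D) <= (1 + delta) * y]. *)
have yD : (1 + delta / 2) * D / (delta / 2) <= y.
  by near: y; apply: nbhs_pinfty_ge; exact: num_real.
rewrite UE//=; have := HD y (ltW y0); have := le_U (ltW y0).
rewrite -{1 2}(fineK (U_fin_num (ltW y0))) !lee_fin => yu uy.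
have u1 : 1 <= fine (U Q X e y) / y by rewrite ler_pdivlMr// mul1r.
rewrite ler0_norm ?subr_le0// opprB lerBlDl ler_pdivrMr//.
move: yD; rewrite ler_pdivrMr//; lra.
Unshelve. all: by end_near.
Qed.

End conclusion.

Lemma measurable_integral_law (g : R -> \bar R) :
  (forall x, 0 <= g x)%E -> measurable_fun setT g ->
  measurable_fun [set: law R] (fun m => \int[m : probability R R]_x g x)%E.
Proof.
move=> g0 mg.
apply: (measurable_fun_integral_kernel (l := fun m : law R => (m : probability R R))) => //.
move=> B mB.
exact: (measurable_kernel (kprobability (@measurable_id _ (law R) setT)) _ mB).
Qed.

(* [fair] is [centered] with a finite moment, in a form that is visibly
   measurable in the law. *)
Definition fair m := (moment eps (m : probability R R) < +oo)%E /\
  (\int[m : probability R R]_x (EFin^\+ x) =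
   \int[m : probability R R]_x (EFin^\- x))%E.

Lemma measurable_moment :
  measurable_fun [set: law R] (fun m => moment eps (m : probability R R)).
Proof.
apply: measurable_integral_law => [x|]; first by rewrite lee_fin powR_ge0.
by apply/measurable_EFinP; exact: measurable_moment_fun.
Qed.

Lemma measurable_small_part M :
  measurable_fun [set: law R] (fun m => small_part M (m : probability R R)).
Proof.
apply: measurable_integral_law => [x|].
  by rewrite lee_fin; case: ifP => // _; exact: sqr_ge0.
by apply/measurable_EFinP; exact: measurable_small_fun.
Qed.

Lemma measurable_fair : measurable [set m | fair m].
Proof.
rewrite (_ : [set m | fair m] =
  [set m | moment eps (m : probability R R) < +oo]%E `&`
  [set m | \int[m : probability R R]_x (EFin^\+ x) =
           \int[m : probability R R]_x (EFin^\- x)]%E)//.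
have mE : measurable_fun setT (@EFin R) by [].
apply: measurableI.
  rewrite -[X in measurable X]setTI; apply: emeasurable_fun_infty_o => //.
  exact: measurable_moment.
rewrite -[X in measurable X]setTI; apply: measurable_eqe => //.
  by apply: measurable_integral_law => [x|]; [exact: funepos_ge0|exact: (measurable_funepos mE)].
by apply: measurable_integral_law => [x|]; [exact: funeneg_ge0|exact: (measurable_funeneg mE)].
Qed.

Hypothesis eps0 : 0 < eps.

(** [|x|] is at most 1 plus its power [2 + eps]. *)
Lemma moment_integrable (m : probability R R) :
  (moment eps m < +oo)%E -> m.-integrable setT EFin.
Proof.
move=> mfin.
have mf : measurable_fun setT (fun x : R => (`|x| `^ (2 + eps))%:E).
  by apply/measurable_EFinP; exact: measurable_moment_fun.
have im : m.-integrable setT (fun x : R => (`|x| `^ (2 + eps))%:E).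
  apply/integrableP; split => //.
  by under eq_integral do rewrite gee0_abs ?lee_fin ?powR_ge0//.
have i1 : m.-integrable setT (cst 1%:E) by exact: finite_measure_integrable_cst.
apply: le_integrable (integrableD measurableT i1 im) => //.
move=> x _ /=; rewrite lee_fin [leRHS]ger0_norm ?addr_ge0 ?powR_ge0//.
have [x1|x1] := leP `|x| 1; first by rewrite (le_trans x1)// lerDl powR_ge0.
apply: (@le_trans _ _ (`|x| `^ (2 + eps))); last by rewrite lerDr.
by apply: le1r_powR; [exact: ltW|move: eps0; lra].
Qed.

Lemma fair_centered (m : probability R R) : fair m -> centered m.
Proof.
move=> [/moment_integrable im E]; split=> //.
rewrite integralE E subee//.
exact: integrable_neg_fin_num.
Qed.

Lemma centered_fair (m : probability R R) : (moment eps m < +oo)%E ->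
  (\int[m]_x x%:E = 0)%E -> fair m.
Proof.
move=> mfin; have im := moment_integrable mfin; rewrite integralE => E.
split=> //; move: E.
have /fineK <- := integrable_neg_fin_num measurableT im.
have /fineK <- := integrable_pos_fin_num measurableT im.
by rewrite -EFinB => -[/eqP]; rewrite subr_eq0 => /eqP ->.
Qed.

Lemma le_small_part (m : probability R R) (M N : R) : M <= N ->
  (small_part M m <= small_part N m)%E.
Proof.
move=> MN; apply: ge0_le_integral => //.
- by move=> x _; rewrite lee_fin; case: ifP => // _; exact: sqr_ge0.
- by apply/measurable_EFinP; exact: measurable_small_fun.
- by apply/measurable_EFinP; exact: measurable_small_fun.
- move=> x _; rewrite lee_fin; case: ifP => [/andP[-> xM]|_].
    by rewrite (le_trans xM MN).
  by case: ifP => // _; exact: sqr_ge0.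
Qed.

(** Small parts increase with the cut-off, so bounds tending to 0 force all of them to vanish. By
    Markov's inequality each interval [[k.+1^-1, k.+1]] is then null, and these exhaust the
    half-line. *)
Lemma small_part_eq0 (m : probability R R) :
  (forall k, fine (small_part k.+1%:R m) < k.+1%:R^-1) -> m `]0, +oo[%classic = 0%E.
Proof.
move=> H.
have Z k : small_part k.+1%:R m = 0%E.
  apply: le_anti; rewrite small_part_ge0 andbT.
  have c0 : EFin \o @harmonic R @ \oo --> 0%E.
    by apply: cvg_EFin; [exact: nearW|exact: cvg_harmonic].
  rewrite -(cvg_lim _ c0)//; apply: lime_ge; first by apply/cvg_ex; eexists; exact: c0.
  exists k => // n /= kn; apply: (@le_trans _ _ (small_part n.+1%:R m)).
    by apply: le_small_part; rewrite ler_nat.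
  by rewrite -(fineK (small_part_fin_num _ _)) lee_fin ltW.
have -> : `]0, +oo[%classic = \bigcup_k `[k.+1%:R^-1, k.+1%:R]%classic :> set R.
  apply/seteqP; split => [x|x [k _]]; rewrite /= in_itv/= ?andbT.
    move=> x0.
    have [k] : exists k : nat, (x < k.+1%:R) /\ (x^-1 < k.+1%:R).
      exists (Num.bound (Num.max x x^-1)).
      have : Num.max x x^-1 < (Num.bound (Num.max x x^-1))%:R.
        by apply: archi_boundP; rewrite le_max ltW.
      rewrite gt_max => /andP[a b].
      by split; [apply: lt_trans a _|apply: lt_trans b _]; rewrite ltr_nat.
    move=> [xk xVk]; exists k => //=; rewrite in_itv/= (ltW xk) andbT.
    by rewrite -[x]invrK lef_pV2 ?posrE ?invr_gt0// ltW.
  move=> /andP[kx _]; rewrite in_itv/= andbT.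
  by apply: lt_le_trans kx; rewrite invr_gt0.
apply/negligibleP; first by apply: bigcupT_measurable => k; exact: measurable_itv.
apply: negligible_bigcup => k; apply/negligibleP; first exact: measurable_itv.
have mI : measurable `[k.+1%:R^-1 : R, k.+1%:R]%classic by exact: measurable_itv.
set I := `[_, _]%classic in mI *.
have c0 : 0 < (k.+1%:R^-1) ^+ 2 :> R by rewrite exprn_gt0// invr_gt0.
suff : (((k.+1%:R^-1) ^+ 2)%:E * \int[m]_x (\1_I x)%:E <= small_part k.+1%:R m)%E.
  rewrite integral_indic// setIT Z pmule_rle0 ?lte_fin// => mI0.
  by apply: le_anti; rewrite mI0 measure_ge0.
have mi : measurable_fun setT (fun x => (\1_I x)%:E : \bar R).
  by apply/measurable_EFinP; exact: measurable_indic.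
have i0 x : setT x -> (0 <= (\1_I x)%:E :> \bar R)%E by rewrite lee_fin.
have c0' : (0 <= ((k.+1%:R^-1 : R) ^+ 2)%:E)%E by rewrite lee_fin ltW.
rewrite -(ge0_integralZl m measurableT mi i0 c0').
apply: ge0_le_integral => //.
- exact: emeasurable_funM.
- by apply/measurable_EFinP; exact: measurable_small_fun.
move=> x _; rewrite -EFinM lee_fin indicE; have [|_] := boolP (x \in _).
  rewrite inE /I /= in_itv/= => /andP[kx xk]; rewrite mulr1 xk.
  have x0 : 0 < x by apply: lt_le_trans kx; rewrite invr_gt0.
  by rewrite x0 /= lerXn2r ?nnegrE ?invr_ge0// ltW.
by rewrite mulr0; case: ifP => // _; exact: sqr_ge0.
Qed.

End good_environment.

(** * Almost every environment is good *)

Section almost_every_environment.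
Context (R : realType) (dE : measure_display) (OmegaE : measurableType dE).
Context (P : probability OmegaE R) (xi : nat -> {mfun OmegaE >-> law R}).
Hypothesis xi_stationary : stationary_env P xi.

Lemma measurable_env_at :
  measurable_fun setT (env_at xi : OmegaE -> env_space R).
Proof. by apply: measurable_to_env => n; exact: measurable_funP. Qed.

HB.instance Definition _ := isMeasurableFun.Build _ _ OmegaE (env_space R)
  (env_at xi : OmegaE -> env_space R) measurable_env_at.

Let env : {mfun OmegaE >-> env_space R} := env_at xi : OmegaE -> env_space R.
(** The shift acts on sequences and not on [OmegaE], so the ergodic inequalities are applied to the
    law of the environment. *)
Let mu : probability (env_space R) R := distribution P env.

Lemma env_stationary (A : set (env_space R)) : measurable A ->
  mu (@theta R @^-1` A) = mu A.
Proof. exact: xi_stationary. Qed.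

Lemma iter_theta k (e : environment R) : iter k (@theta R) e 0%N = e k.
Proof.
suff H n : iter k (@theta R) e n = e (n + k)%N by rewrite H.
elim: k n => [|k IH] n; first by rewrite addn0.
by rewrite iterS /theta IH addSnnS.
Qed.

Lemma ae_env (G : environment R -> Prop) :
  {ae mu, forall e, G e} -> {ae P, forall w, G (env_at xi w)}.
Proof.
move=> [B [mB B0 GB]]; exists (env @^-1` B); split => //.
- by rewrite -[X in measurable X]setTI; exact: (measurable_env_at measurableT mB).
- by move=> w /= nG; apply: GB.
Qed.

Lemma env_null (A : set (env_space R)) : measurable A ->
  {ae P, forall w, ~ A (env_at xi w)} -> mu A = 0%E.
Proof.
move=> mA nA.
have mEA : measurable (env @^-1` A).
  by rewrite -[X in measurable X]setTI; exact: (measurable_env_at measurableT mA).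
transitivity (P (env @^-1` A)) => //; apply/(negligibleP _ mEA).
by apply: negligibleS nA => w /= Aw; exact.
Qed.

Lemma ae_good (eps : R) : 0 < eps ->
  {ae P, forall w, (\int[xi 0%N w : probability R R]_x x%:E = 0)%E} ->
  (\int[P]_w moment eps (xi 0%N w : probability R R) < +oo)%E ->
  {ae P, forall w, (0 < (xi 0%N w : probability R R) `]0%R, +oo[%classic)%E} ->
  {ae P, forall w, good eps (env_at xi w)}.
Proof.
move=> eps0 centered_xi moment_xi pos_xi; apply: ae_env.
have mth := @measurable_theta R.
have minv := env_stationary.
pose first (e : env_space R) : law R := e 0%N.
have mfirst : measurable_fun setT first by exact: measurable_coordinate.
have mmom : measurable_fun setT (fun e => moment eps (first e : probability R R)).
  exact: (measurableT_comp (measurable_moment eps) mfirst).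
have mom0 (m : probability R R) : (0 <= moment eps m)%E.
  by apply: integral_ge0 => x _; rewrite lee_fin powR_ge0.
have int_mom : (\int[mu]_e moment eps (first e : probability R R) < +oo)%E.
  by rewrite ge0_integral_distribution.
have mA : measurable (first @^-1` (~` [set m | fair eps m])).
  rewrite -[X in measurable X]setTI; apply: mfirst => //.
  by apply: measurableC; exact: measurable_fair.
have fair0 : mu (first @^-1` (~` [set m | fair eps m])) = 0%E.
  apply: env_null => //.
  have mom_fin : {ae P, forall w, (moment eps (xi 0%N w : probability R R) < +oo)%E}.
    have : P.-integrable setT (fun w => moment eps (xi 0%N w : probability R R)).
      apply/integrableP; split.
        exact: (measurableT_comp (measurable_moment eps) (measurable_funP (xi 0%N))).
      by under eq_integral do rewrite gee0_abs//.
    move=> /(integrable_ae measurableT); apply: filterS => w /(_ I).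
    by rewrite ge0_fin_numE.
  apply: filterS2 mom_fin centered_xi => w mw cw /= nf; apply: nf.
  exact: centered_fair.
have msmall (m : nat) : measurable_fun setT (fun e => fine (small_part m.+1%:R (first e : probability R R))).
  apply: measurableT_comp => //.
  exact: (measurableT_comp (measurable_small_part _) mfirst).
(* By [small_part_eq0] the first law of such an environment does not charge the positive half-line,
   against [pos_xi]. *)
have small0 : mu [set e : env_space R |
    forall m : nat, fine (small_part m.+1%:R (first e : probability R R)) < m.+1%:R^-1] = 0%E.
  apply: env_null.
    rewrite (_ : [set _ | _] = \bigcap_m [set e : env_space R |
      fine (small_part m.+1%:R (first e : probability R R)) < m.+1%:R^-1]).
      by apply: bigcapT_measurable => m; exact: measurable_ltr_set.
    by apply/seteqP; split => e /= H m; [move=> _; exact: H|exact: (H m)].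
  apply: filterS pos_xi => w + H; rewrite small_part_eq0 ?ltxx//.
(* Stationarity carries fairness from the first law to all of them. *)
have ae_fair := ae_iter mth minv mA fair0.
have ae_moment : {ae mu, forall e, exists2 C, 0 <= C &
    forall n, \sum_(k < n) fine (moment eps (first (iter k (@theta R) e) : probability R R))
      <= C * n%:R}.
  (* [ae_sum_le] takes real functions. [fine] turns an infinite moment into 0, which loses nothing
     since [ae_fair] excludes infinite moments. *)
  apply: (ae_sum_le mth minv (f := fun e => fine (moment eps (first e : probability R R)))).
  - by move=> e; exact: fine_ge0.
  - by apply: measurableT_comp => //.
  - apply: le_lt_trans int_mom; apply: ge0_le_integral => //.
    + by move=> e _; rewrite lee_fin fine_ge0.
    + by apply/measurable_EFinP; apply: measurableT_comp => //.
    + by move=> e _; have := mom0 (first e); case: (moment _ _).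
have ae_small : {ae mu, forall e, exists m : nat, exists2 c, 0 < c &
    forall n, c * n%:R <= \sum_(k < n)
      fine (small_part m.+1%:R (first (iter k (@theta R) e) : probability R R))}.
  apply: (ae_sum_ge mth minv (g := fun m e =>
    fine (small_part m.+1%:R (first e : probability R R)))) => //.
  - by move=> m e; rewrite fine_ge0// small_part_ge0.
  - move=> e m n mn; apply: fine_le; rewrite ?small_part_fin_num//.
    by apply: le_small_part; rewrite ler_nat.
apply: filterS3 ae_fair ae_moment ae_small => e fe [C C0 HC] [m [c c0 Hc]].
have fairk k : fair eps (e k).
  by have := fe k; rewrite /= /first iter_theta => /contrapT.
split; [|split].
- by move=> k; exact: (fair_centered eps0 (fairk k)).
- exists C => // n; have := HC n; rewrite -lee_fin; apply: le_trans.
  rewrite big_mkord -sumEFin; apply: lee_sum => k _.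
  rewrite /first iter_theta fineK// ge0_fin_numE//.
  by have [] := fairk k.
- exists m.+1%:R, c; split => // n.
  have := Hc n; rewrite -lee_fin => /le_trans; apply.
  rewrite big_mkord -sumEFin; apply: lee_sum => k _.
  by rewrite /first iter_theta fineK// small_part_fin_num.
Qed.

End almost_every_environment.

(** * Translation of the hypotheses on the first increment into its law *)

Section first_increment.
Context (R : realType) (d : measure_display) (Omega : measurableType d).
Context (Q : environment R -> probability Omega R).
Context (X : nat -> {mfun Omega >-> R}).
Hypothesis X_quenched : quenched_increments Q X.
Implicit Type e : environment R.
Local Open Scope ereal_scope.

Lemma ge0_integral_X e (f : R -> \bar R) :
  (forall x, 0 <= f x) -> measurable_fun setT f ->
  \int[Q e]_x f (X 0%N x) = \int[e 0%N : probability R R]_x f x.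
Proof.
move=> f0 mf; have [_ law_e] := X_quenched e.
transitivity (\int[distribution (Q e) (X 0%N)]_x f x).
  by rewrite ge0_integral_distribution.
by apply: eq_measure_integral => A mA _; exact: law_e.
Qed.

(** Positive and negative parts are transferred separately, so that no integrability is
    presupposed. *)
Lemma expectation_X e :
  'E_(Q e)[X 0%N] = \int[e 0%N : probability R R]_x x%:E.
Proof.
have mE : measurable_fun setT (@EFin R) by [].
rewrite expectation_def integralE [RHS]integralE; congr (_ - _).
- rewrite -ge0_integral_X//; [|exact: measurable_funepos].
  by apply: eq_integral => x _; rewrite !funeposE.
- rewrite -ge0_integral_X//; [|exact: measurable_funeneg].
  by apply: eq_integral => x _; rewrite !funenegE.
Qed.

Lemma moment_X e eps :
  \int[Q e]_x (`|X 0%N x| `^ (2 + eps))%:E = moment eps (e 0%N : probability R R).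
Proof.
apply: (@ge0_integral_X e (fun x : R => (`|x| `^ (2 + eps))%:E)) => [x|].
  by rewrite lee_fin powR_ge0.
by apply/measurable_EFinP; exact: measurable_moment_fun.
Qed.

Lemma probability_X_gt0 e :
  Q e [set x | (0 < X 0%N x)%R] = (e 0%N : probability R R) `]0%R, +oo[%classic.
Proof.
have [_ law_e] := X_quenched e; rewrite -law_e; last exact: measurable_itv.
congr (Q e _); apply/seteqP; split => x /=; by rewrite in_itv/= andbT.
Qed.

End first_increment.

Lemma measurable_env_at_sigma_xi (R : realType) (dE : measure_display)
    (OmegaE : measurableType dE) (xi : nat -> {mfun OmegaE >-> law R}) :
  measurable_fun [set: sigma_xi xi] (env_at xi : sigma_xi xi -> env_space R).
Proof.
apply: measurable_to_env => n _ A mA; rewrite setTI; apply: sub_sigma_algebra.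
by exists n => //; exists A => //; rewrite setTI.
Qed.

Theorem theorem1p2 (R : realType)
    (dE : measure_display) (OmegaE : measurableType dE)
    (P : probability OmegaE R) (xi : nat -> {mfun OmegaE >-> law R})
    (d : measure_display) (Omega : measurableType d)
    (Q : environment R -> probability Omega R)
    (X : nat -> {mfun Omega >-> R})
    (xi_stationary : stationary_env P xi)
    (xi_ergodic : ergodic_env P xi)
    (X_quenched : quenched_increments Q X)
    (X_centered : {ae P, forall w, ('E_(Q (env_at xi w))[X 0%N] = 0)%E})
    (X_moment : exists2 eps : R, 0 < eps &
       (annealed Q P xi (fun _ x => (`|X 0%N x| `^ (2 + eps))%:E)
          < +oo)%E)
    (X_pos : {ae P, forall w,
       (0 < Q (env_at xi w) [set x | (0 < X 0%N x)%R])%E}) :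
  (* 1. *)
  (forall y : R, 0 <= y ->
     measurable_fun [set: sigma_xi xi]
       (fun w : sigma_xi xi => U Q X (env_at xi w) y)) /\
  {ae P, forall w, forall y : R, 0 <= y ->
     U Q X (env_at xi w) y =
     quenched_on Q (env_at xi w)
       (fun x => U Q X (theta (env_at xi w)) (y + walk X 1 x))
       [set x | (1%:E < tau X y x)%E]} /\
  (* 2. *)
  {ae P, forall w,
     [/\ forall y : R, 0 <= y -> (0 < U Q X (env_at xi w) y < +oo)%E,
         forall y z : R, 0 <= y -> y <= z ->
           (U Q X (env_at xi w) y <= U Q X (env_at xi w) z)%E
       & (U Q X (env_at xi w) y / y%:E)%E @[y --> +oo] --> 1%:E]}.
Proof.
split=> [y y0|].
  apply: (measurableT_comp (measurable_U X_quenched y0)).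
  exact: measurable_env_at_sigma_xi.
have [eps eps0 moment_fin] := X_moment.
(* A single null set is discarded; off it the claims hold for all [y] simultaneously. *)
have G : {ae P, forall w, good eps (env_at xi w)}.
  apply: (ae_good xi_stationary eps0).
  - by apply: filterS X_centered => w; rewrite (expectation_X X_quenched).
  - move: moment_fin; rewrite /annealed.
    by under eq_integral do rewrite (moment_X X_quenched).
  - by apply: filterS X_pos => w; rewrite (probability_X_gt0 X_quenched).
split; apply: filterS G => w gw.
  by move=> y y0; apply: U_harmonic => //; exact: gw.1.
split.
- move=> y y0; rewrite (U_gt0 X_quenched gw y0) /=.
  by rewrite ltey_eq (U_fin_num X_quenched eps0 gw y0).
- by move=> y z y0 yz; apply: U_nondecreasing => //; exact: gw.1.
- exact: (cvg_U_div X_quenched eps0 gw).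
Qed.
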